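(* Let $\Gamma$ be a finitely generated group and let $(\phi,\mathbb F)$ represent an element of $\partial\,\Xi(\Gamma,\mathrm{PSL}_2(\mathbb R))^{\mathrm{RSp}}_{\mathrm{cl}}$, with $\mathbb F$ a $\phi$-minimal real closed field. The $\mathbb F_{\mathcal O}$-extension $o_{\mathbb F_{\mathcal O}}(z_1,z_2,z_3)=\mathrm{sgn}\det(z_2-z_1,z_3-z_2)$ of the cyclic order of the circle defines a cyclic order on the set of germs of oriented segments $\mathcal G_{T\mathbb F}(p)\cong\mathbb S^1(\mathbb F_{\mathcal O})$ for every $p\in T\mathbb F\subset T\mathbb F^{\mathrm{sc}}$. Together with the trivial (zero) cyclic order at the points of $T\mathbb F^{\mathrm{sc}}\setminus T\mathbb F$, where there are exactly two germs, this gives an orientation on the $\mathbb R$-tree $T\mathbb F^{\mathrm{sc}}$, denoted $or_{\mathcal O}$.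
   Context: **Boundary elements.** A representation $\phi\colon\Gamma\to\mathrm{PSL}_2(\mathbb F)$, $\mathbb F$ real closed, is reductive if $\mathrm{Ad}\circ\phi$ (conjugation on $M_{2\times2}(\mathbb F)$) is completely reducible; $\mathbb F$ is $\phi$-minimal if $\phi$ cannot be $\mathrm{PSL}_2(\mathbb F)$-conjugated into $\mathrm{PSL}_2(\mathbb L)$ for a proper real closed subfield $\mathbb L$. Elements of the boundary $\partial\,\Xi(\Gamma,\mathrm{PSL}_2(\mathbb R))^{\mathrm{RSp}}_{\mathrm{cl}}$ of the real spectrum compactification of the character variety correspond bijectively (known result) to equivalence classes of pairs $(\phi,\mathbb F)$ with $\phi\colon\Gamma\to\mathrm{PSL}_2(\mathbb F)$ reductive and $\mathbb F$ real closed, non-Archimedean and $\phi$-minimal; such $\mathbb F$ has finite transcendence degree over the real algebraic numbers and therefore a big element, i.e. $\beta>0$ such that for every $c\in\mathbb F$ there is $k\in\mathbb N$ with $c<\beta^k$. Fix such $\beta$. **Valuation.** For $h>0$ in $\mathbb F$, $\log_\beta(h)\in\mathbb R$ is the real number given by the Dedekind cut $\{m/n:\beta^m\le h^n,\ m\in\mathbb Z,\ n\in\mathbb N_{>0}\}$; $\Lambda=\log_\beta(\mathbb F_{>0})$. $\mathcal O=\{h:h=0\text{ or }\log_\beta|h|\le0\}$, $\mathcal J=\{h:h=0\text{ or }\log_\beta|h|<0\}$, and $\mathbb F_{\mathcal O}=\mathcal O/\mathcal J$, an ordered real closed field for which $\mathcal O\to\mathbb F_{\mathcal O}$ is (weakly)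 order preserving. **Tree.** $\mathbb H^2(\mathbb F)=\{z=x+iy\in\mathbb F[i]:x^2+y^2<1\}$ has the pseudo-distance $\log_\beta\big(\|1-\bar zz'\|^2/((1-\|z\|^2)(1-\|z'\|^2))\big)$, where $\|x+iy\|=\sqrt{x^2+y^2}$, preserved by the Möbius action of $\mathrm{PSL}_2(\mathbb F)$ (via the Cayley transform). The quotient $\pi\colon\mathbb H^2(\mathbb F)\to T\mathbb F$ identifying points at pseudo-distance $0$ is a $\Lambda$-tree, and $T\mathbb F^{\mathrm{sc}}$ is the $\mathbb R$-tree obtained by replacing each $\Lambda$-segment by its metric completion. **Germs.** $\mathcal G_X(p)$ is the set of nondegenerate oriented segments starting at $p$, two being identified if they agree on some $[0,\varepsilon)$. Bijection (Brumfiel): at $p_0=\pi(0)$, sending $u\in\mathbb S^1(\mathbb F)=\{x+iy\in\mathbb F[i]:x^2+y^2=1\}$ to the germ at $p_0$ of $\pi(\{tu:0\le t<1\})$ induces a bijection $\mathbb S^1(\mathbb F_{\mathcal O})=\{x+iy\in \mathbb F_{\mathcal O}[i]:x^2+y^2=1\}\cong\mathcal G_{T\mathbb F}(p_0)$ (two $u$'s give the same germ iff they have the same reduction); for $p=\pi(g\cdot0)$, $g\in\mathrm{PSL}_2(\mathbb F)$, translate by $g$. The germs at $p\in T\mathbb F$ in $T\mathbb F$ and in $T\mathbb F^{\mathrm{sc}}$ are in natural bijection. **Cyclic order, orientation.** A cyclic order on $\Omega$ is $o\colon\Omega^3\to\{-1,0,1\}$ with (1) $o(z_1,z_2,z_3)=0$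 iff $\mathrm{Card}\{z_1,z_2,z_3\}\le2$; (2) $o(z_1,z_2,z_3)=o(z_2,z_3,z_1)=-o(z_1,z_3,z_2)$; (3) $o(z_1,z_2,z_3)=1=o(z_1,z_3,z_4)$ implies $o(z_1,z_2,z_4)=1$. An orientation of an $\mathbb R$-tree is a cyclic order on the germs at each of its points. *)

(* Defs.v *)
From HB Require Import structures.
From mathcomp Require Import all_boot all_order all_algebra.
From mathcomp Require Import all_classical all_reals all_analysis.
From mathcomp Require Import complex ring lra.

Set Implicit Arguments.
Unset Strict Implicit.
Unset Printing Implicit Defensive.

Import Order.TTheory GRing.Theory Num.Theory.
Import numFieldNormedType.Exports.
Local Open Scope classical_set_scope.
Local Open Scope ring_scope.

Section SL2.
Variable F : fieldType.

Record SL2 := MkSL2 { SL2_val :> 'M[F]_2; SL2_det : \det SL2_val == 1 }.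

HB.instance Definition _ := [isSub of SL2 for SL2_val].
HB.instance Definition _ := [Choice of SL2 by <:].

Fact SL2_one_subproof : \det (1%:M : 'M[F]_2) == 1.
Proof. by rewrite det1. Qed.
Fact SL2_mul_subproof (A B : SL2) : \det (A *m B) == 1.
Proof. by rewrite det_mulmx (eqP (SL2_det A)) (eqP (SL2_det B)) mulr1. Qed.
Fact SL2_inv_subproof (A : SL2) : \det (invmx A) == 1.
Proof. by rewrite det_inv (eqP (SL2_det A)) invr1. Qed.

Definition SL2_one : SL2 := MkSL2 SL2_one_subproof.
Definition SL2_mul A B := MkSL2 (SL2_mul_subproof A B).
Definition SL2_inv A := MkSL2 (SL2_inv_subproof A).

Fact SL2_unit (A : SL2) : (A : 'M[F]_2) \in unitmx.
Proof. by rewrite unitmxE (eqP (SL2_det A)) unitr1. Qed.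

Fact SL2_mulA : associative SL2_mul.
Proof. by move=> A B C; apply/val_inj; rewrite /= mulmxA. Qed.
Fact SL2_mul1 : left_id SL2_one SL2_mul.
Proof. by move=> A; apply/val_inj; rewrite /= mul1mx. Qed.
Fact SL2_mulr1 : right_id SL2_one SL2_mul.
Proof. by move=> A; apply/val_inj; rewrite /= mulmx1. Qed.
Fact SL2_mulV : left_inverse SL2_one SL2_inv SL2_mul.
Proof. by move=> A; apply/val_inj; rewrite /= mulVmx ?SL2_unit. Qed.
Fact SL2_mulrV : right_inverse SL2_one SL2_inv SL2_mul.
Proof. by move=> A; apply/val_inj; rewrite /= mulmxV ?SL2_unit. Qed.

HB.instance Definition _ :=
  isGroup.Build SL2 SL2_mulA SL2_mul1 SL2_mulr1 SL2_mulV SL2_mulrV.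

Definition eq_up_to_sign (A B : SL2) :=
  ((A : 'M[F]_2) == B) || ((A : 'M[F]_2) == - (B : 'M[F]_2)).

Fact eq_up_to_sign_refl : reflexive eq_up_to_sign.
Proof. by move=> A; rewrite /eq_up_to_sign eqxx. Qed.
Fact eq_up_to_sign_sym : symmetric eq_up_to_sign.
Proof. by move=> A B; rewrite /eq_up_to_sign eq_sym -eqr_oppLR [- _ == _]eq_sym. Qed.
Fact eq_up_to_sign_trans : transitive eq_up_to_sign.
Proof.
move=> B A C /orP[]/eqP AB /orP[]/eqP BC; rewrite /eq_up_to_sign AB BC ?opprK.
all: by rewrite eqxx ?orbT.
Qed.

Canonical eq_up_to_sign_equiv :=
  EquivRel eq_up_to_sign eq_up_to_sign_refl eq_up_to_sign_sym
    eq_up_to_sign_trans.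

Definition PSL2 := {eq_quot eq_up_to_sign}%qT.
HB.instance Definition _ := Choice.on PSL2.
HB.instance Definition _ : EqQuotient SL2 eq_up_to_sign PSL2 :=
  EqQuotient.on PSL2.

Definition toPSL2 (A : SL2) : PSL2 := \pi_PSL2%qT A.

Definition PSL2_one : PSL2 := toPSL2 1%g.
Definition PSL2_mul (g h : PSL2) : PSL2 := toPSL2 (repr g * repr h)%g.
Definition PSL2_inv (g : PSL2) : PSL2 := toPSL2 (repr g)^-1%g.

Fact toPSL2P (A B : SL2) : reflect (toPSL2 A = toPSL2 B) (eq_up_to_sign A B).
Proof. by apply: (iffP idP) => [|/eqmodP//]; move=> /eqmodP. Qed.

Fact repr_toPSL2 (A : SL2) : eq_up_to_sign (repr (toPSL2 A)) A.
Proof. by apply/toPSL2P; rewrite /toPSL2 reprK. Qed.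

Fact toPSL2M (A B : SL2) : PSL2_mul (toPSL2 A) (toPSL2 B) = toPSL2 (A * B)%g.
Proof.
apply/toPSL2P; rewrite /eq_up_to_sign /=.
case/orP: (repr_toPSL2 A) => /eqP->; case/orP: (repr_toPSL2 B) => /eqP->;
  by rewrite ?mulNmx ?mulmxN ?opprK eqxx ?orbT.
Qed.

Fact toPSL2V (A : SL2) : PSL2_inv (toPSL2 A) = toPSL2 A^-1%g.
Proof.
apply/toPSL2P; rewrite /eq_up_to_sign /=.
case/orP: (repr_toPSL2 A) => /eqP->; first by rewrite eqxx.
have N1 : -1 \is a @GRing.unit F by rewrite unitrN1.
by rewrite -scaleN1r invmxZ ?unitmxZ ?SL2_unit// invrN1 scaleN1r eqxx orbT.
Qed.

Fact toPSL2K (g : PSL2) : toPSL2 (repr g) = g.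
Proof. by rewrite /toPSL2 reprK. Qed.

Fact PSL2_mulA : associative PSL2_mul.
Proof.
by move=> a b c; rewrite -[a]toPSL2K -[b]toPSL2K -[c]toPSL2K !toPSL2M mulgA.
Qed.
Fact PSL2_mul1 : left_id PSL2_one PSL2_mul.
Proof. by move=> a; rewrite -[a]toPSL2K toPSL2M mul1g. Qed.
Fact PSL2_mulr1 : right_id PSL2_one PSL2_mul.
Proof. by move=> a; rewrite -[a]toPSL2K toPSL2M mulg1. Qed.
Fact PSL2_mulV : left_inverse PSL2_one PSL2_inv PSL2_mul.
Proof. by move=> a; rewrite -[a]toPSL2K toPSL2V toPSL2M mulVg. Qed.
Fact PSL2_mulrV : right_inverse PSL2_one PSL2_inv PSL2_mul.
Proof. by move=> a; rewrite -[a]toPSL2K toPSL2V toPSL2M mulgV. Qed.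

HB.instance Definition _ :=
  isGroup.Build PSL2 PSL2_mulA PSL2_mul1 PSL2_mulr1 PSL2_mulV PSL2_mulrV.

End SL2.

Section SL2_map.
Variables (L F : fieldType) (iota : {rmorphism L -> F}).

Fact SL2_map_subproof (A : SL2 L) : \det (map_mx iota A) == 1.
Proof. by rewrite det_map_mx (eqP (SL2_det A)) rmorph1. Qed.

Definition SL2_map (A : SL2 L) : SL2 F := MkSL2 (SL2_map_subproof A).

Definition PSL2_map (g : PSL2 L) : PSL2 F := toPSL2 (SL2_map (repr g)).

End SL2_map.

Definition finitely_generated (G : groupType) : Prop :=
  exists s : seq G, forall H : set G,
    H 1%g -> (forall x y, H x -> H y -> H (x * y)%g) ->
    (forall x, H x -> H (x^-1)%g) ->
    (forall x, x \in s -> H x) -> H = setT.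

(* Conjugation does not depend on the sign of the representative. *)
Definition Ad (F : fieldType) (g : PSL2 F) (X : 'M[F]_2) : 'M[F]_2 :=
  repr g *m X *m invmx (repr g).

Definition reductive (Gamma : groupType) (F : fieldType)
    (phi : {multiplicative Gamma -> PSL2 F}) : Prop :=
  let invariant (V : {vspace 'M[F]_2}) :=
    forall x X, X \in V -> Ad (phi x) X \in V in
  forall V, invariant V ->
    exists W, [/\ invariant W, (V + W)%VS = fullv & (V :&: W)%VS = 0%VS].

(* Real closed subfields of [F] are given as images of field morphisms from
   real closed fields; such morphisms are automatically increasing, since
   positive elements are squares. *)
Definition minimal_field (Gamma : groupType) (F : rcfType)
    (phi : {multiplicative Gamma -> PSL2 F}) : Prop :=
  forall (L : rcfType) (iota : {rmorphism L -> F}),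
    (exists g : PSL2 F, forall x, exists h : PSL2 L,
        (g * phi x * g^-1)%g = PSL2_map iota h) ->
    forall y : F, exists x : L, iota x = y.

Definition nonarchimedean (F : rcfType) : Prop :=
  exists x : F, forall n : nat, n%:R < x.

Record bigElement (F : rcfType) := BigElement {
  big_val :> F;
  big_gt0 : 0 < big_val;
  big_dom : forall c : F, exists k : nat, c < big_val ^+ k
}.

Section Log.
Variables (R : realType) (F : rcfType) (beta : bigElement F).
Local Notation b := (big_val beta).

Definition log_cut (h : F) : set R :=
  [set q | exists (m : int) (n : nat),
     [/\ (0 < n)%N, b ^ m <= h ^+ n & q = m%:~R / n%:R]].

(* Only meaningful for [0 < h]. *)
Definition logb (h : F) : R := sup (log_cut h).

Definition value_group : set R := [set logb h | h in [set h : F | 0 < h]].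

Fact big_gt1 : 1 < b.
Proof.
rewrite ltNge; apply/negP => b1.
have [k] := big_dom beta 1; rewrite ltNge => /negP; apply.
by rewrite exprn_ile1// ltW// big_gt0.
Qed.

Fact big_expz_mono (m n : int) : (b ^ m <= b ^ n) = (m <= n).
Proof. by rewrite (ler_eXz2l big_gt1). Qed.

Fact has_sup_log_cut (h : F) : 0 < h -> has_sup (log_cut h).
Proof.
move=> h0; split.
  have [k] := big_dom beta h^-1 => hk.
  exists (- k%:Z)%:~R; exists (- k%:Z), 1%N; split => //; last by rewrite divr1.
  by rewrite expr1 -invr_expz invf_ple ?posrE ?exprz_gt0 ?big_gt0// ltW.
have [k hk] := big_dom beta h.
exists k%:R => _ [m [n [n0 mn ->]]].
rewrite ler_pdivrMr ?ltr0n// -natrM -[(k * n)%:R]/((k * n)%N%:Z%:~R) ler_int.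
rewrite -big_expz_mono (le_trans mn)//.
by rewrite -exprnP exprM lerXn2r ?nnegrE ?exprn_ge0 ?ltW ?big_gt0.
Qed.

Fact logb_le0P (h : F) : 0 < h ->
  reflect (forall n, h ^+ n < b) (logb h <= 0).
Proof.
move=> h0; apply: (iffP idP) => [h1 n|hn].
  case: n => [|n]; first by rewrite expr0 big_gt1.
  rewrite ltNge; apply/negP => bh.
  have : (n.+1)%:R^-1 <= 0 :> R.
    apply: le_trans h1; apply: ub_le_sup.
      by case: (has_sup_log_cut h0).
    by exists 1, n.+1; split => //; rewrite mul1r.
  by rewrite leNgt invr_gt0 ltr0n.
apply: ge_sup; first by case: (has_sup_log_cut h0).
move=> _ [m [n [n0 mn ->]]].
rewrite pmulr_lle0 ?invr_gt0 ?ltr0n// lerz0 leNgt; apply/negP => m0.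
have : b ^ (1 : int) <= b ^ m.
  by rewrite big_expz_mono -[1]add0r lezD1.
by rewrite leNgt => /negP; apply; rewrite (le_lt_trans mn)// expr1z.
Qed.

Fact logb_lt0P (h : F) : 0 < h ->
  (logb h < 0) <-> (exists n, b * h ^+ n < 1).
Proof.
move=> h0; split => [hl|[n bn]].
  have [N hN] : exists N : nat, logb h < - (N.+1)%:R^-1.
    exists (Num.truncn (- logb h)^-1).
    rewrite ltrNr -[X in _ < X]invrK ltf_pV2 ?posrE ?ltr0n ?invr_gt0 ?oppr_gt0//.
    exact: truncnS_gt.
  exists N.+1; rewrite ltNge; apply/negP => bh.
  move: hN; rewrite ltNge => /negP; apply.
  apply: ub_le_sup; first by case: (has_sup_log_cut h0).
  exists (-1), N.+1; split => //; last by rewrite mulN1r.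
  by rewrite -invr_expz expr1z -[_ ^-1]mulr1 ler_pdivrMl ?big_gt0.
case: n bn => [|n bn]; first by rewrite expr0 mulr1 => /(lt_trans big_gt1); rewrite ltxx.
apply: (@le_lt_trans _ _ (- (n.+1)%:R^-1)); last first.
  by rewrite oppr_lt0 invr_gt0 ltr0n.
apply: ge_sup; first by case: (has_sup_log_cut h0).
move=> _ [m [k [k0 mk ->]]].
have hb : h ^+ n.+1 <= b ^ (-1 : int).
  by rewrite -invr_expz expr1z -[_ ^-1]mulr1 ler_pdivlMl ?big_gt0// ltW.
have : b ^ (m * n.+1) <= b ^ (-1 * k%:Z).
  rewrite -!exprz_exp -!exprnP; apply: (@le_trans _ _ ((h ^+ k) ^+ n.+1)).
    by rewrite lerXn2r ?nnegrE ?exprn_ge0 ?exprz_ge0// ltW// big_gt0.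
  by rewrite [(h ^+ k) ^+ _]exprAC lerXn2r ?nnegrE ?exprn_ge0 ?exprz_ge0// ltW// big_gt0.
rewrite big_expz_mono mulN1r -(ler_int R) rmorphM rmorphN /= => mnk.
by rewrite ler_pdivrMr ?ltr0n// mulNr lerNr ler_pdivrMl ?ltr0n// mulrN mulrC lerNr.
Qed.

End Log.
Arguments value_group R {F} beta _.

Section Residue.
Variables (R : realType) (F : rcfType).
Variables (Fna : nonarchimedean F) (beta : bigElement F).
Local Notation b := (big_val beta).

(* [Fna] is a dummy argument: it makes this set closed under addition, so that
   the instances below can be inferred. *)
Definition val_ring of nonarchimedean F : {pred F} :=
  [pred h : F | (h == 0) || (logb R beta `|h| <= 0)].
Local Notation O := (val_ring Fna).

Fact big_gt_nat (n : nat) : n%:R < b.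
Proof.
case: n => [|n]; first exact: big_gt0.
have [x xn] := Fna; have [k xk] := big_dom beta x.
rewrite ltNge; apply/negP => bn.
have : b ^+ k <= (n.+1 ^ k)%:R.
  by rewrite natrX lerXn2r ?nnegrE ?ler0n// ltW ?big_gt0.
by rewrite leNgt => /negP; apply; apply: lt_trans xk; exact: xn.
Qed.

Fact val_ringP (h : F) : reflect (forall n, `|h| ^+ n < b) (h \in O).
Proof.
rewrite inE; have [->|h0] := eqVneq h 0.
  apply: ReflectT => n; rewrite normr0 expr0n.
  by case: n => [|n] /=; rewrite ?big_gt0 ?big_gt1.
by apply: logb_le0P; rewrite normr_gt0.
Qed.

Fact sqr_ltr (x : F) n : `|x| ^+ (2 * n) < b ^+ 2 -> `|x| ^+ n < b.
Proof.
by rewrite mulnC exprM ltr_pXn2r ?nnegrE ?exprn_ge0// ltW// big_gt0.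
Qed.

Fact normD_exp (x y : F) n :
  `|x + y| ^+ n <= 2 ^+ n * Num.max `|x| `|y| ^+ n.
Proof.
rewrite -exprMn lerXn2r ?nnegrE ?mulr_ge0 ?le_max ?normr_ge0//.
apply: le_trans (ler_normD _ _) _; rewrite mulr_natl mulr2n lerD//.
  by rewrite le_max lexx.
by rewrite le_max lexx orbT.
Qed.

Fact val_ring_subring : subring_closed O.
Proof.
have b0 := big_gt0 beta; have b1 := big_gt1 beta.
split=> [|x y /val_ringP xO /val_ringP yO|x y /val_ringP xO /val_ringP yO].
- by apply/val_ringP => n; rewrite normr1 expr1n big_gt1.
- apply/val_ringP => n; apply: sqr_ltr.
  apply: le_lt_trans (normD_exp _ _ _) _; rewrite normrN.
  rewrite [b ^+ 2]expr2; apply: ltr_pM; rewrite ?exprn_ge0 ?le_max ?normr_ge0//.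
    by rewrite -natrX big_gt_nat.
  by case: (leP `|x| `|y|).
- apply/val_ringP => n; apply: sqr_ltr.
  by rewrite normrM exprMn [b ^+ 2]expr2 ltr_pM ?exprn_ge0.
Qed.
HB.instance Definition _ := GRing.isSubringClosed.Build F O val_ring_subring.

Record valRing := MkValRing { valRing_val :> F; valRingP : valRing_val \in O }.
HB.instance Definition _ := [isSub of valRing for valRing_val].
HB.instance Definition _ := [Choice of valRing by <:].
HB.instance Definition _ := [SubChoice_isSubComNzRing of valRing by <:].

Definition val_ideal : {pred valRing} :=
  [pred h : valRing | (val h == 0) || (logb R beta `|val h| < 0)].

Fact val_idealP (h : valRing) :
  (h \in val_ideal) <-> (exists n, b * `|val h| ^+ n < 1).
Proof.
rewrite inE; have [->|h0] := eqVneq (val h) 0.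
  by split => // _; exists 1%N; rewrite normr0 expr1 mulr0.
by apply: logb_lt0P; rewrite normr_gt0.
Qed.

Fact small_sqr (c M : F) n : 0 <= c -> c <= b -> 0 <= M -> b * M ^+ n < 1 ->
  b * (c * M ^+ (2 * n)) < 1.
Proof.
move=> c0 cb M0 Mn; have b0 := big_gt0 beta.
apply: (@le_lt_trans _ _ ((b * M ^+ n) ^+ 2)).
  rewrite exprMn expr2 -mulrA -exprM [(n * 2)%N]mulnC.
  by rewrite ler_pM2l// ler_wpM2r// exprn_ge0.
by rewrite exprn_ilt1 ?mulr_ge0 ?exprn_ge0 ?(ltW b0).
Qed.

Fact val_idealM (a x : valRing) : x \in val_ideal -> a * x \in val_ideal.
Proof.
move=> /val_idealP[n xn]; apply/val_idealP; exists (2 * n)%N.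
rewrite rmorphM normrM exprMn small_sqr ?exprn_ge0//.
by apply: ltW; have /val_ringP := valRingP a; apply.
Qed.

Fact val_idealD (x y : valRing) :
  x \in val_ideal -> y \in val_ideal -> x + y \in val_ideal.
Proof.
move=> /val_idealP[n xn] /val_idealP[m ym]; apply/val_idealP.
have [k Mk] : exists k, b * Num.max `|val x| `|val y| ^+ k < 1.
  by case: (leP `|val x| `|val y|) => _; [exists m | exists n].
exists (2 * k)%N; rewrite rmorphD /=.
apply: (@le_lt_trans _ _
    (b * (2 ^+ (2 * k) * Num.max `|val x| `|val y| ^+ (2 * k)))).
  by rewrite ler_pM2l ?big_gt0// normD_exp.
rewrite small_sqr ?exprn_ge0 ?le_max ?normr_ge0//.
by rewrite -natrX ltW// big_gt_nat.
Qed.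

Fact val_ideal_ideal : idealr_closed val_ideal.
Proof.
split=> [||a x y xJ yJ]; first by rewrite inE eqxx.
  apply/negP => /val_idealP[n]; rewrite rmorph1 normr1 expr1n mulr1.
  by move=> /(lt_trans (big_gt1 beta)); rewrite ltxx.
by rewrite val_idealD// val_idealM.
Qed.
HB.instance Definition _ := isIdealr.Build valRing val_ideal val_ideal_ideal.

Fact val_ideal_convex (x y : valRing) :
  y \in val_ideal -> `|val x| <= `|val y| -> x \in val_ideal.
Proof.
move=> /val_idealP[n yn] xy; apply/val_idealP; exists n.
apply: le_lt_trans yn; rewrite ler_pM2l ?big_gt0//.
by rewrite lerXn2r ?nnegrE.
Qed.

Fact val_unit (x : valRing) : x \notin val_ideal -> (val x)^-1 \in O.
Proof.
move=> xJ; have xn n : 1 <= b * `|val x| ^+ n.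
  by rewrite leNgt; apply: contra xJ => xn; apply/val_idealP; exists n.
have x0 : val x != 0 by apply: contra xJ => /eqP x0; rewrite inE x0 eqxx.
apply/val_ringP => n; apply: sqr_ltr; have b0 := big_gt0 beta.
apply: (@le_lt_trans _ _ b).
  by rewrite normfV exprVn -[_ ^-1]mul1r ler_pdivrMr ?exprn_gt0 ?normr_gt0.
by rewrite expr2 ltr_pMr// big_gt1.
Qed.

Definition resField := {ideal_quot val_ideal}.
HB.instance Definition _ := GRing.ComNzRing.on resField.

Definition residue_class (x : valRing) : resField := \pi_resField%qT x.

Fact residue_classE (x y : valRing) :
  (residue_class x == residue_class y) = (x - y \in val_ideal).
Proof. by rewrite Quotient.idealrBE. Qed.

Fact residue_classB : zmod_morphism residue_class.
Proof. by move=> x y; rewrite /residue_class rmorphB. Qed.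
Fact residue_classM : monoid_morphism residue_class.
Proof. by split=> [|x y]; rewrite /residue_class ?rmorph1 ?rmorphM. Qed.
HB.instance Definition _ :=
  GRing.isZmodMorphism.Build valRing resField residue_class residue_classB.
HB.instance Definition _ :=
  GRing.isMonoidMorphism.Build valRing resField residue_class residue_classM.

Fact residue_classK (q : resField) : residue_class (repr q) = q.
Proof. by rewrite /residue_class reprK. Qed.

Fact residue_class_eq0 (x : valRing) :
  (residue_class x == 0) = (x \in val_ideal).
Proof. by rewrite -(rmorph0 residue_class) residue_classE subr0. Qed.

Definition resField_inv (q : resField) : resField :=
  if q == 0 then 0 else residue_class (insubd 0 (val (repr q))^-1).

Fact resField_mulV (q : resField) : q != 0 -> resField_inv q * q = 1.
Proof.
move=> q0; rewrite /resField_inv (negbTE q0) -{2}[q]residue_classK.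
have qJ : repr q \notin val_ideal by rewrite -residue_class_eq0 residue_classK.
rewrite -rmorphM -(rmorph1 residue_class); congr residue_class; apply/val_inj.
rewrite rmorphM rmorph1 /= insubdK ?val_unit// mulVf//.
by apply: contra qJ => q0'; rewrite inE; apply/orP; left.
Qed.

Fact resField_inv0 : resField_inv 0 = 0.
Proof. by rewrite /resField_inv eqxx. Qed.

HB.instance Definition _ :=
  GRing.ComNzRing_isField.Build resField resField_mulV resField_inv0.

Definition resField_lt (p q : resField) :=
  (q != p) && (val (repr p) < val (repr q)).
Definition resField_le (p q : resField) := (p == q) || resField_lt p q.
Definition resField_norm (q : resField) := if resField_le 0 q then q else - q.

Fact resField_ltE (x y : valRing) :
  resField_lt (residue_class x) (residue_class y) =
  (y - x \notin val_ideal) && (val x < val y).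
Proof.
rewrite /resField_lt residue_classE.
have [//|yx /=] := boolP (y - x \in val_ideal).
have lt_mono (u v u' v' : valRing) :
    u' - u \in val_ideal -> v' - v \in val_ideal ->
    v - u \notin val_ideal -> val u < val v -> val u' < val v'.
  move=> uJ vJ; rewrite !ltNge => vu uv; apply: contra vu => v'u'.
  have wJ : (u' - u) - (v' - v) \in val_ideal by rewrite rpredB.
  apply: val_ideal_convex wJ _; rewrite !rmorphB /=.
  move: uv v'u' => /=; rewrite -ltNge => uv v'u'.
  rewrite gtr0_norm ?subr_gt0// ler_normr; apply/orP; left; lra.
have cJ (z : valRing) : repr (residue_class z) - z \in val_ideal.
  by rewrite -residue_classE residue_classK.
have cJ' (z : valRing) : z - repr (residue_class z) \in val_ideal.
  by rewrite -opprB rpredN.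
apply/idP/idP; apply: lt_mono => //.
by rewrite -residue_classE !residue_classK residue_classE.
Qed.

Fact resField_leE (x y : valRing) :
  resField_le (residue_class x) (residue_class y) =
  (y - x \in val_ideal) || (val x < val y).
Proof.
rewrite /resField_le residue_classE resField_ltE -opprB rpredN.
by case: (_ \in _).
Qed.

Fact resField_sub_ge0 p q : resField_le 0 (q - p) = resField_le p q.
Proof.
rewrite -[p]residue_classK -[q]residue_classK -rmorphB -(rmorph0 residue_class).
by rewrite !resField_leE subr0 rmorphB rmorph0 subr_gt0.
Qed.

Fact resField_ge0P q :
  reflect (exists2 x, 0 <= val x & q = residue_class x) (resField_le 0 q).
Proof.
apply: (iffP idP) => [|[x x0 ->]]; last first.
  rewrite -(rmorph0 residue_class) resField_leE subr0 rmorph0.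
  move: x0; rewrite le_eqVlt => /orP[/eqP x0|->]; last by rewrite orbT.
  by rewrite inE -x0 eqxx.
rewrite -{1}[q]residue_classK -(rmorph0 residue_class) resField_leE subr0 rmorph0.
case/orP => [qJ|q0]; last by exists (repr q); rewrite ?residue_classK// ltW.
exists 0; rewrite ?rmorph0//; apply/eqP.
by rewrite -[q]residue_classK residue_class_eq0.
Qed.

Fact resField_addr_ge0 p q :
  resField_le 0 p -> resField_le 0 q -> resField_le 0 (p + q).
Proof.
move=> /resField_ge0P[x x0 ->] /resField_ge0P[y y0 ->]; apply/resField_ge0P.
by exists (x + y); rewrite ?rmorphD// addr_ge0.
Qed.

Fact resField_mulr_ge0 p q :
  resField_le 0 p -> resField_le 0 q -> resField_le 0 (p * q).
Proof.
move=> /resField_ge0P[x x0 ->] /resField_ge0P[y y0 ->]; apply/resField_ge0P.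
by exists (x * y); rewrite ?rmorphM// mulr_ge0.
Qed.

Fact resField_le0_anti q : resField_le 0 q -> resField_le q 0 -> q = 0.
Proof.
rewrite -[q]residue_classK -(rmorph0 residue_class) !resField_leE !subr0 sub0r.
rewrite rpredN rmorph0 -residue_class_eq0 => /orP[/eqP->|q0].
  by rewrite rmorph0.
by case/orP => [/eqP->|/(lt_trans q0)]; rewrite ?rmorph0 ?ltxx.
Qed.

Fact resField_le0_total q : resField_le 0 q || resField_le q 0.
Proof.
rewrite -[q]residue_classK -(rmorph0 residue_class) !resField_leE subr0 sub0r.
rewrite rpredN rmorph0; case: ltgtP => //= q0; rewrite ?orbT//.
have -> // : repr q \in val_ideal.
by rewrite inE; apply/orP; left; apply/eqP; exact: esym q0.
Qed.

Fact resField_normN q : resField_norm (- q) = resField_norm q.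
Proof.
have le0N p : resField_le 0 (- p) = resField_le p 0.
  by rewrite -sub0r resField_sub_ge0.
rewrite /resField_norm le0N.
case: ifPn => [q0|]; last first.
  by have := resField_le0_total q; rewrite opprK => /orP[->|->].
case: ifPn => // q1; by rewrite (resField_le0_anti q1 q0) oppr0.
Qed.

Fact resField_ger0_norm q : resField_le 0 q -> resField_norm q = q.
Proof. by rewrite /resField_norm => ->. Qed.

Fact resField_lt_def p q : resField_lt p q = (q != p) && resField_le p q.
Proof.
rewrite /resField_le /resField_lt [p == q]eq_sym.
by case: eqVneq.
Qed.

HB.instance Definition _ := Num.IntegralDomain_isLeReal.Build resField
  resField_addr_ge0 resField_mulr_ge0 resField_le0_anti resField_sub_ge0
  resField_le0_total resField_normN resField_ger0_norm resField_lt_def.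

(* Junk value [0] outside the valuation ring. *)
Definition residue (h : F) : resField := residue_class (insubd 0 h).

End Residue.

Definition cyclic_order (T : Type) (Omega : set T)
    (o : T -> T -> T -> int) : Prop :=
  (forall x y z, Omega x -> Omega y -> Omega z ->
     [/\ o x y z \in [:: -1; 0; 1],
         o x y z = 0 <-> ([set x; y; z] #<= `I_2)%card,
         o x y z = o y z x & o x y z = - o x z y]) /\
  (forall x y z t, Omega x -> Omega y -> Omega z -> Omega t ->
     o x y z = 1 -> o x z t = 1 -> o x y t = 1).

(* Segments are isometric embeddings of [0, l] intersected with [L], for [L] a
   subgroup of [R]: [L] is the value group, or [setT] for real segments. The
   values of the path outside this domain are junk. *)
Record segment (R : realType) (X : Type) := Segment {
  seg_len : R;
  seg_path : R -> X
}.

Section Trees.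
Variables (R : realType) (L : set R) (X : Type) (d : X -> X -> R).
Implicit Types s t : segment R X.

Definition seg_dom s : set R := [set a | L a /\ 0 <= a <= seg_len s].
Definition seg_image s : set X := seg_path s @` seg_dom s.
Definition seg_start s : X := seg_path s 0.
Definition seg_end s : X := seg_path s (seg_len s).

Definition is_segment s : Prop :=
  [/\ L (seg_len s), 0 <= seg_len s &
      forall a c, seg_dom s a -> seg_dom s c ->
        d (seg_path s a) (seg_path s c) = `|a - c|].

Definition nondeg_segment s : Prop := is_segment s /\ 0 < seg_len s.

Definition same_germ s t : Prop :=
  exists e, [/\ 0 < e, e <= seg_len s, e <= seg_len t &
    forall a, L a -> 0 <= a < e -> seg_path s a = seg_path t a].

Definition germ s : set (segment R X) :=
  [set t | nondeg_segment t /\ same_germ s t].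

Definition germs (p : X) : set (set (segment R X)) :=
  [set germ s | s in [set s | nondeg_segment s /\ seg_start s = p]].

Definition is_metric : Prop :=
  [/\ forall x y, d x y = 0 <-> x = y,
      forall x y, d x y = d y x &
      forall x y z, d x z <= d x y + d y z].

Definition is_tree : Prop :=
  [/\ is_metric,
      forall x y, exists s,
        [/\ is_segment s, seg_start s = x & seg_end s = y],
      forall s t, is_segment s -> is_segment t -> seg_start s = seg_start t ->
        seg_image s `&` seg_image t = [set seg_start s] ->
        exists2 r, is_segment r & seg_image r = seg_image s `|` seg_image t &
      forall s t, is_segment s -> is_segment t -> seg_start s = seg_start t ->
        exists2 r, is_segment r & seg_image r = seg_image s `&` seg_image t].

End Trees.

Definition is_Rtree (R : realType) (X : Type) (d : X -> X -> R) : Prop :=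
  is_tree setT d.

Definition orientation (R : realType) (X : Type) (d : X -> X -> R)
    (o : forall p : X,
       set (segment R X) -> set (segment R X) -> set (segment R X) -> int) :
    Prop :=
  is_Rtree d /\ forall p, cyclic_order (germs setT d p) (o p).

Section SeparatedQuotient.
Variables (R : realType) (T : Type) (d : T -> T -> R).

Definition sepQuot : Type := {A : set T | exists x, A = [set y | d x y = 0]}.

Definition sep_pi (x : T) : sepQuot :=
  exist _ [set y | d x y = 0] (ex_intro _ x erefl).

Definition sep_repr (A : sepQuot) : T := projT1 (cid (svalP A)).

Definition sep_dist (A B : sepQuot) : R := d (sep_repr A) (sep_repr B).

End SeparatedQuotient.

(* Gluing the metric completions of all [L]-segments amounts to taking the
   union of the closures of these segments in the metric completion; that is,
   Cauchy sequences contained in some segment, up to distance zero. *)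
Section SegmentCompletion.
Variables (R : realType) (L : set R) (X : Type) (d : X -> X -> R).

Record segSequence := SegSequence {
  seg_seq :> nat -> X;
  seg_seq_in : exists2 s, is_segment L d s & forall n, seg_image L s (seg_seq n);
  seg_seq_cauchy : forall e, 0 < e -> exists N, forall m n,
    (N <= m)%N -> (N <= n)%N -> d (seg_seq m) (seg_seq n) < e
}.

Definition seg_seq_dist (u v : segSequence) : R := limn (fun n => d (u n) (v n)).

Definition segCompletion : Type := sepQuot seg_seq_dist.
Definition segCompletion_dist : segCompletion -> segCompletion -> R :=
  @sep_dist R segSequence seg_seq_dist.

End SegmentCompletion.

Section Disk.
Variable F : rcfType.
Local Notation iC := (Complex 0 1 : F[i]).
Local Notation "x %:C" := (real_complex F x).

(* [||z||^2] as an element of [F]; only squares of norms are needed. *)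
Definition sqnormc (z : F[i]) : F := complex.Re z ^+ 2 + complex.Im z ^+ 2.

Record disk := Disk { disk_val :> F[i]; disk_lt1 : sqnormc disk_val < 1 }.
HB.instance Definition _ := [isSub of disk for disk_val].

Fact sqnormc0 : sqnormc 0 < 1.
Proof. by rewrite /sqnormc /= expr0n addr0 ltr01. Qed.
Definition origin : disk := Disk sqnormc0.

Definition cayley (w : F[i]) : F[i] := (w - iC) / (w + iC).
Definition cayley_inv (z : F[i]) : F[i] := iC * (1 + z) / (1 - z).

Definition mobius (A : SL2 F) (w : F[i]) : F[i] :=
  ((A 0 0)%:C * w + (A 0 1)%:C) / ((A 1 0)%:C * w + (A 1 1)%:C).

Fact Im_div (z w : F[i]) : complex.Im (z / w) =
  (complex.Im z * complex.Re w - complex.Re z * complex.Im w) / sqnormc w.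
Proof.
case: z w => [x y] [u v] /=; rewrite /sqnormc /=; ring.
Qed.

Fact sqnormcM (z w : F[i]) : sqnormc (z * w) = sqnormc z * sqnormc w.
Proof. by case: z w => [x y] [u v]; rewrite /sqnormc /=; ring. Qed.

Fact sqnormc_gt0 (z : F[i]) : z != 0 -> 0 < sqnormc z.
Proof.
case: z => x y; rewrite eq_complex /sqnormc /= negb_and => xy.
rewrite lt_neqAle addr_ge0 ?sqr_ge0// andbT eq_sym paddr_eq0 ?sqr_ge0//.
by rewrite !sqrf_eq0 negb_and.
Qed.

Fact cayley_inv_gt0 (z : F[i]) : sqnormc z < 1 -> 0 < complex.Im (cayley_inv z).
Proof.
move=> z1; rewrite Im_div divr_gt0 ?sqnormc_gt0//; last first.
  by apply: contraTneq z1 => /subr0_eq<-; rewrite /sqnormc /= expr1n expr0n addr0 ltxx.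
case: z z1 => x y; rewrite /sqnormc /=; lra.
Qed.

Fact mobius_gt0 (A : SL2 F) (w : F[i]) :
  0 < complex.Im w -> 0 < complex.Im (mobius A w).
Proof.
have detA : A 0 0 * A 1 1 - A 0 1 * A 1 0 = 1.
  rewrite -(eqP (SL2_det A)) (expand_det_row _ 0) !big_ord_recl big_ord0.
  rewrite /cofactor !det_mx11 !mxE /= addr0 /bump /=.
  have -> : lift ord0 ord0 = 1 :> 'I_2 by apply/val_inj.
  have -> : lift 1 0 = 0 :> 'I_2 by apply/val_inj.
  ring.
case: w => x y y0; rewrite /mobius Im_div divr_gt0 ?sqnormc_gt0//=.
  have -> : forall a c e f : F, (a * y + 0 * x + 0) * (e * x - 0 * y + f) -
      (a * x - 0 * y + c) * (e * y + 0 * x + 0) = y * (a * f - c * e).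
    by move=> *; ring.
  by rewrite detA mulr1.
rewrite eq_complex /= negb_and -implybE; apply/implyP => /eqP cxf.
apply/eqP => cy; move: detA => /eqP; apply/negP.
have c0 : A 1 0 = 0.
  apply/eqP; move: cy; rewrite mul0r !addr0 => /eqP.
  by rewrite mulf_eq0 (gt_eqF y0) orbF.
move: cxf; rewrite c0 !mul0r subr0 add0r => ->.
by rewrite !mulr0 subr0 eq_sym oner_eq0.
Qed.

Fact cayley_lt1 (w : F[i]) : 0 < complex.Im w -> sqnormc (cayley w) < 1.
Proof.
case: w => x y /= y0.
have wi : Complex x y + iC != 0.
  rewrite eq_complex /= negb_and; apply/orP; right.
  by rewrite gt_eqF// addr_gt0.
rewrite -(ltr_pM2r (sqnormc_gt0 wi)) -sqnormcM mul1r /cayley divfK//.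
rewrite /sqnormc /=; lra.
Qed.

Fact disk_act_subproof (g : PSL2 F) (z : disk) :
  sqnormc (cayley (mobius (repr g) (cayley_inv z))) < 1.
Proof. exact/cayley_lt1/mobius_gt0/cayley_inv_gt0/disk_lt1. Qed.

Definition disk_act (g : PSL2 F) (z : disk) : disk :=
  Disk (disk_act_subproof g z).

End Disk.

Section CyclicOrderCircle.
Variable K : realFieldType.
Implicit Types z : K[i].

Definition circle : set K[i] :=
  [set z | complex.Re z ^+ 2 + complex.Im z ^+ 2 = 1].

Definition col_of_complex z : 'cV[K]_2 :=
  \col_(i < 2) (if i == 0 then complex.Re z else complex.Im z).

Definition circle_order z1 z2 z3 : int :=
  sgz (\det (row_mx (col_of_complex (z2 - z1)) (col_of_complex (z3 - z2)) : 'M[K]_2)).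

End CyclicOrderCircle.

Section Tree.
Variables (R : realType) (F : rcfType).
Variables (Fna : nonarchimedean F) (beta : bigElement F).
Local Notation K := (resField R Fna beta).
Local Notation Lambda := (value_group R beta).

Definition disk_dist (z w : disk F) : R :=
  logb R beta (sqnormc (1 - conjc z * w) / ((1 - sqnormc z) * (1 - sqnormc w))).

Definition tree : Type := sepQuot disk_dist.
Definition tree_pi : disk F -> tree := @sep_pi R (disk F) disk_dist.
Definition tree_dist : tree -> tree -> R := @sep_dist R (disk F) disk_dist.

Fact logb1 : logb R beta 1 = 0.
Proof.
apply/eqP; rewrite eq_le; apply/andP; split.
  by apply/logb_le0P => // n; rewrite expr1n big_gt1.
rewrite leNgt; apply/negP => /logb_lt0P[//|n].
by rewrite expr1n mulr1 => /(lt_trans (big_gt1 beta)); rewrite ltxx.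
Qed.

Fact tree_dist_refl (p : tree) : tree_dist p p = 0.
Proof.
rewrite /tree_dist /sep_dist /disk_dist; case: (sep_repr p) => -[x y] /= z1.
rewrite -[RHS]logb1; congr logb; rewrite /sqnormc /= in z1 *.
rewrite -[RHS](@mulfV _ ((1 - (x ^+ 2 + y ^+ 2)) ^+ 2)); last first.
  by rewrite expf_eq0 /= subr_eq0 gt_eqF.
rewrite [in X in _ / X]expr2; congr (_ / _); ring.
Qed.

Definition tree_sc : Type := segCompletion Lambda tree_dist.
Definition tree_sc_dist : tree_sc -> tree_sc -> R :=
  @segCompletion_dist R Lambda tree tree_dist.

Section Constant.
Variable p : tree.
Fact const_seq_in :
  exists2 s, is_segment Lambda tree_dist s &
             forall n : nat, seg_image Lambda s p.
Proof.
have L0 : Lambda 0 by exists 1; [exact: ltr01 | exact: logb1].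
exists (Segment 0 (fun=> p)).
  split => //= a c [_ /andP[a0 a1]] [_ /andP[c0 c1]].
  have -> : a = c by apply/eqP; rewrite eq_le (le_trans a1)// (le_trans c1).
  by rewrite tree_dist_refl subrr normr0.
by move=> _; exists 0 => //; split => //=; rewrite lexx.
Qed.

Fact const_seq_cauchy (e : R) : 0 < e -> exists N, forall m n : nat,
  (N <= m)%N -> (N <= n)%N -> tree_dist p p < e.
Proof. by move=> e0; exists 0%N => m n _ _; rewrite tree_dist_refl. Qed.

Definition tree_incl : tree_sc :=
  sep_pi (@seg_seq_dist R Lambda tree tree_dist)
    (@SegSequence R Lambda tree tree_dist (fun=> p) const_seq_in const_seq_cauchy).
End Constant.

Definition tree_germs : tree -> set (set (segment R tree)) :=
  germs Lambda tree_dist.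
Definition tree_sc_germs : tree_sc -> set (set (segment R tree_sc)) :=
  germs setT tree_sc_dist.

(* The path of [g] applied to the ray through [u], parametrized by arc length:
   the point [t u] is at distance [log (1 / (1 - t^2))] from the origin. *)
Definition ray_point (u : F[i]) (t : F) : disk F :=
  insubd (origin F) (real_complex F t * u).
Definition ray_param (a : R) : F :=
  xget 0 [set t : F | 0 <= t < 1 /\ logb R beta (1 - t ^+ 2)^-1 = a].
Definition ray (g : PSL2 F) (u : F[i]) : segment R tree :=
  Segment 1 (fun a => tree_pi (disk_act g (ray_point u (ray_param a)))).
Definition ray_germ (g : PSL2 F) (u : F[i]) : set (segment R tree) :=
  germ Lambda tree_dist (ray g u).

Definition base_point (g : PSL2 F) : tree := tree_pi (disk_act g (origin F)).

Definition reduce (u : F[i]) : K[i] :=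
  Complex (residue R Fna beta (complex.Re u)) (residue R Fna beta (complex.Im u)).

(* The inverse of the bijection from the circle of the residue field to the
   germs at [base_point g]. *)
Definition germ_direction (g : PSL2 F) (gamma : set (segment R tree)) : K[i] :=
  xget 0 [set v | exists u, [/\ circle u, reduce u = v & ray_germ g u = gamma]].

Definition some_translation (p : tree) : PSL2 F :=
  xget 1%g [set g | base_point g = p].

Definition tree_order (p : tree) (c1 c2 c3 : set (segment R tree)) : int :=
  let dir := germ_direction (some_translation p) in
  circle_order (dir c1) (dir c2) (dir c3).

Definition restrict_germ (c : set (segment R tree_sc)) : set (segment R tree) :=
  [set s | nondeg_segment Lambda tree_dist s /\
     exists2 S, c S & exists e, [/\ 0 < e, e <= seg_len s, e <= seg_len S &
       forall a, Lambda a -> 0 <= a < e ->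
         seg_path S a = tree_incl (seg_path s a)]].

Definition or_O (P : tree_sc) (c1 c2 c3 : set (segment R tree_sc)) : int :=
  match pselect (exists p, tree_incl p = P) with
  | left inT => tree_order (projT1 (cid inT))
                  (restrict_germ c1) (restrict_germ c2) (restrict_germ c3)
  | right _ => 0
  end.

End Tree.

Arguments tree R {F} beta.
Arguments tree_dist R {F} beta.
Arguments tree_sc R {F} beta.
Arguments tree_sc_dist R {F} beta.
Arguments tree_germs {R F beta} p.
Arguments tree_sc_germs {R F beta} P.
Arguments tree_incl {R F beta} p.
Arguments circle K _ : clear implicits.
Arguments base_point R {F} beta g.
Arguments ray_germ R {F} beta g u.
Arguments reduce R {F} Fna beta u.
Arguments tree_order {R F} Fna {beta} p c1 c2 c3.
Arguments or_O {R F} Fna {beta} P c1 c2 c3.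

(* Main.v *)
(* The pairing 1 - z^* w on the disk is a hermitian form of signature (1,1) in
   two variables; the vanishing of its 3 x 3 Gram determinants gives Ptolemy's
   inequality up to a bounded factor. Since log_beta kills bounded factors, the
   pseudo-distance is exactly 0-hyperbolic, and everything metric about TF and
   TF^sc (segments, medians, germs) follows from the four-point inequality. In
   particular a point of TF^sc outside TF is not a branch point, since medians
   of points of TF have coordinates in Lambda.

   For the germs at g.0, N(1 - t^2 u^* v) compares 1 - t^2 with u - v, so the
   rays through u and v start in the same way iff log_beta N(u - v) < 0. If
   g.0 = g'.0 in TF, then k = g'^-1 g lies in SU(1,1) over the valuation ring;
   it maps the ray through u to the ray through k u, and the three-point
   determinant of k u_1, k u_2, k u_3 differs from that of u_1, u_2, u_3 by a
   positive unit, so that the order on germs does not depend on g. *)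
Require Import Defs.
From HB Require Import structures.
From mathcomp Require Import all_boot all_order all_algebra.
From mathcomp Require Import all_classical all_reals all_analysis.
From mathcomp Require Import complex ring lra.

Set Implicit Arguments.
Unset Strict Implicit.
Unset Printing Implicit Defensive.

Import Order.TTheory GRing.Theory Num.Theory.
Import numFieldNormedType.Exports.
Local Open Scope classical_set_scope.
Local Open Scope ring_scope.

(** * Germs and cyclic orders *)

Section Germs.
Variables (R : realType) (L : set R) (X : Type) (d : X -> X -> R).
Implicit Types s t r : segment R X.

Lemma same_germ_refl s : nondeg_segment L d s -> same_germ L s s.
Proof. by move=> [_ s0]; exists (seg_len s); split. Qed.

Lemma same_germ_sym s t : same_germ L s t -> same_germ L t s.
Proof.
by move=> [e [e0 es et st]]; exists e; split=> // a La ae; rewrite st.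
Qed.

Lemma same_germ_trans s t r :
  same_germ L s t -> same_germ L t r -> same_germ L s r.
Proof.
move=> [e [e0 es et st]] [f [f0 ft fr tr]].
exists (Num.min e f); split; rewrite ?lt_min ?ge_min ?e0 ?es ?fr ?orbT//.
by move=> a La /andP[a0]; rewrite lt_min => /andP[ae af]; rewrite st ?tr ?a0.
Qed.

Lemma germ_refl s : nondeg_segment L d s -> germ L d s s.
Proof. by move=> sn; split=> //; exact: same_germ_refl. Qed.

Lemma germ_eq s t : nondeg_segment L d t ->
  germ L d s = germ L d t <-> same_germ L s t.
Proof.
move=> tn; split=> [st|st].
  by have [] : germ L d s t by rewrite st; exact: germ_refl.
apply/seteqP; split=> r [rn]; split=> //.
  exact: same_germ_trans (same_germ_sym st) _.
exact: same_germ_trans st _.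
Qed.

End Germs.

Lemma card_eq_set2 (T : Type) (x y : T) : x <> y -> ([set x; y] #= `I_2)%card.
Proof.
move=> xy; apply/eq_cardSP; exists x; first by left.
have -> : [set x; y] `\ x = [set y]; last exact: card_set1.
apply/seteqP; split=> [z [[]->]|z ->]; [by case|by []|].
by split; [right|move=> yx; exact/xy/esym].
Qed.

Lemma card_le_set2 (T : Type) (x y : T) : ([set x; y] #<= `I_2)%card.
Proof.
have [->|xy] := pselect (x = y); last first.
  by have := card_eq_set2 xy; rewrite card_eq_le => /andP[].
by rewrite setUid (card_le_eql card_set1) card_le_II.
Qed.

Lemma card_set3_le2 (T : Type) (x y z : T) :
  ([set x; y; z] #<= `I_2)%card <-> [\/ x = y, y = z | x = z].
Proof.
split=> [le2|eqs].
  apply: contrapT => neqs.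
  have xy : x <> y by move=> e; apply: neqs; apply: Or31.
  have yz : y <> z by move=> e; apply: neqs; apply: Or32.
  have xz : x <> z by move=> e; apply: neqs; apply: Or33.
  suff e3 : ([set x; y; z] #= `I_3)%card.
    by move: le2; rewrite (card_le_eql e3) card_le_II.
  apply/eq_cardSP; exists z; first by right.
  have -> : [set x; y; z] `\ z = [set x; y]; last exact: card_eq_set2.
  apply/seteqP; split=> w.
    by move=> [[//|->]]; case.
  by move=> [] ->; split=> //; left; [left|right].
have [a [b abE]] : exists a b, [set x; y; z] = [set a; b].
  case: eqs => ->; first by exists y, z; rewrite setUid.
    by exists x, z; rewrite -setUA setUid.
  by exists y, z; rewrite setUAC setUid setUC.
by rewrite abE card_le_set2.
Qed.

Lemma cyclic_order_pullback (T U : Type) (A : set T) (B : set U) (f : T -> U)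
    (o : U -> U -> U -> int) :
  (forall x, A x -> B (f x)) ->
  (forall x y, A x -> A y -> f x = f y -> x = y) ->
  cyclic_order B o -> cyclic_order A (fun x y z => o (f x) (f y) (f z)).
Proof.
move=> AB finj [Bo Bt]; split; last first.
  move=> x y z t Ax Ay Az At.
  by apply: Bt; exact: AB.
move=> x y z Ax Ay Az.
have [? o0 ? ?] := Bo _ _ _ (AB _ Ax) (AB _ Ay) (AB _ Az).
split=> //; rewrite o0 !card_set3_le2; split=> -[] e.
- by apply: Or31; exact: finj.
- by apply: Or32; exact: finj.
- by apply: Or33; exact: finj.
- by rewrite e; apply: Or31.
- by rewrite e; apply: Or32.
- by rewrite e; apply: Or33.
Qed.

Lemma cyclic_order_zero (T : Type) (A : set T) :
  (A #<= `I_2)%card -> cyclic_order A (fun _ _ _ => 0).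
Proof.
move=> A2; split=> // x y z Ax Ay Az; split=> //; split=> // _.
by apply: card_le_trans A2; apply: subset_card_le => w [[]|] ->.
Qed.

(** * 0-hyperbolic spaces *)

Section FourPoint.
Variables (R : realType) (X : Type) (d : X -> X -> R).

Definition four_point := forall x y z w,
  d x y + d z w <= Num.max (d x z + d y w) (d x w + d y z).

Definition between x z y := d x z + d z y = d x y.

Hypotheses (dM : is_metric d) (d4 : four_point).

Lemma is_metric_refl x : d x x = 0.
Proof. by case: dM => + _ _; move=> /(_ x x)[_]; exact. Qed.

Lemma is_metric_eq x y : d x y <= 0 -> x = y.
Proof.
case: dM => d0 dC dt xy; apply/d0/eqP; rewrite eq_le xy/=.
have := dt x y x; rewrite is_metric_refl (dC y x); lra.
Qed.

Lemma is_metric_sym x y : d x y = d y x.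
Proof. by case: dM. Qed.

Lemma is_metric_tri x y z : d x z <= d x y + d y z.
Proof. by case: dM. Qed.

Lemma is_metric_ge0 x y : 0 <= d x y.
Proof.
have := is_metric_tri x y x; rewrite is_metric_refl (is_metric_sym y x); lra.
Qed.

Lemma four_pointP x y z w :
  d x y + d z w <= d x z + d y w \/ d x y + d z w <= d x w + d y z.
Proof. by have := d4 x y z w; rewrite le_max => /orP. Qed.

Lemma between_sym x z y : between x z y -> between y z x.
Proof.
rewrite /between (is_metric_sym y z) (is_metric_sym z x).
rewrite (is_metric_sym y x) => <-.
by rewrite addrC.
Qed.

Lemma between_dist x y p q : between x p y -> between x q y ->
  d p q = `|d x p - d x q|.
Proof.
rewrite /between => xpy xqy.
have := four_pointP p q x y.
have := is_metric_tri x p q; have := is_metric_tri x q p.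
rewrite (is_metric_sym q p) (is_metric_sym p x) (is_metric_sym q x).
by case: ger0P => ? ? ? [] ?; apply/eqP; rewrite eq_le; apply/andP; split; lra.
Qed.

Lemma between_inj x y p q : between x p y -> between x q y ->
  d x p = d x q -> p = q.
Proof.
move=> xp xq pq; apply: is_metric_eq.
by rewrite (between_dist xp xq) pq subrr normr0.
Qed.

Lemma between_trans x z w y : between x z w -> between x w y -> between x z y.
Proof.
rewrite /between => xzw xwy.
have := is_metric_tri z w y; have := is_metric_tri x z y.
by move=> *; apply/eqP; rewrite eq_le; apply/andP; split; lra.
Qed.

(* Twice the Gromov product of [y] and [z] at [x]. *)
Definition gromov2 x y z := d x y + d x z - d y z.

Lemma gromov2_sym x y z : gromov2 x y z = gromov2 x z y.
Proof. by rewrite /gromov2; have := is_metric_sym y z; lra. Qed.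

Lemma gromov2_min x y z w :
  gromov2 x y z <= gromov2 x y w \/ gromov2 x z w <= gromov2 x y w.
Proof.
rewrite /gromov2; have := four_pointP y w x z; have := is_metric_sym x y.
have := is_metric_sym w z; have := is_metric_sym w x.
by move=> ? ? ? [] ?; [right|left]; lra.
Qed.

Lemma gromov2_le x y z : gromov2 x y z <= 2 * d x y.
Proof.
by rewrite /gromov2; have := is_metric_tri x y z; lra.
Qed.

Lemma gromov2_ge0 x y z : 0 <= gromov2 x y z.
Proof.
rewrite /gromov2; have := is_metric_tri y x z; have := is_metric_sym x y; lra.
Qed.

Lemma between_gromov2 x y z : between x y z <-> gromov2 x y z = 2 * d x y.
Proof. by rewrite /between /gromov2; split; lra. Qed.

Lemma between_gromov2_0 x y z : between y x z <-> gromov2 x y z = 0.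
Proof. by rewrite /between /gromov2; have := is_metric_sym x y; split; lra. Qed.

Lemma between_common x y z p q : between x p y -> between x q z ->
  d x p = d x q -> 2 * d x p <= gromov2 x y z -> p = q.
Proof.
move=> /between_gromov2 xpy /between_gromov2 xqz pq yz; apply: is_metric_eq.
have := gromov2_min x p y q; have := gromov2_min x y z q.
rewrite (gromov2_sym x z q) /gromov2 in xpy xqz yz *.
by move=> [] ? [] ?; lra.
Qed.

Lemma between_switch x y z p : between x p y -> 2 * d x p <= gromov2 x y z ->
  between x p z.
Proof.
move=> /between_gromov2 xpy yz; apply/between_gromov2/eqP.
rewrite eq_le gromov2_le/=.
by have := gromov2_min x p y z; move=> [] ?; lra.
Qed.

Lemma dist_apart x y z p q : between x p y -> between x q z ->
  gromov2 x y z <= 2 * d x p -> gromov2 x y z <= 2 * d x q ->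
  d p q = d x p + d x q - gromov2 x y z.
Proof.
move=> xpy xqz yzp yzq.
suff : gromov2 x p q = gromov2 x y z by rewrite /gromov2; lra.
apply/eqP; rewrite eq_le; apply/andP; split.
  have := gromov2_min x y p z; have := gromov2_min x p q z.
  move: (xpy) (xqz) => /between_gromov2 yp /between_gromov2 zq.
  have := gromov2_le x p q; have := gromov2_le x q p.
  have := gromov2_sym x y p; have := gromov2_sym x z q.
  have := gromov2_sym x q p; have := gromov2_min x p z q.
  have := gromov2_sym x q z; have := gromov2_sym x p z.
  have := gromov2_min x y z p; move=> h1 ? ? h2 ? ? ? ? ? h3 h4.
  by case: h1 => ?; case: h2 => ?; case: h3 => ?; case: h4 => ?; lra.
move: (xpy) (xqz) => /between_gromov2 yp /between_gromov2 zq.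
have := gromov2_sym x y p; have := gromov2_sym x q z.
have := gromov2_min x p y q; have := gromov2_min x y z q.
by move=> [] ? [] ? ? ?; lra.
Qed.

(* Menger: in a 0-hyperbolic space a choice of intermediate points is
   automatically an isometric path. *)
Lemma segment_exists (L : set R) x y : L 0 -> L (d x y) ->
  (forall a, L a -> 0 <= a <= d x y ->
    exists z, d x z = a /\ between x z y) ->
  exists s, [/\ is_segment L d s, seg_start s = x, seg_end s = y &
    seg_len s = d x y].
Proof.
move=> L0 Lxy ex.
have /choice[f fP] : forall a, exists z, L a -> 0 <= a <= d x y ->
    d x z = a /\ between x z y.
  move=> a; have [[La /(ex a La)[z]]|nLa] := pselect (L a /\ 0 <= a <= d x y).
    by exists z.
  by exists x => La a01; case: nLa.
exists (Segment (d x y) f); split => //.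
- split=> //=; first exact: is_metric_ge0.
  move=> a c [La a01] [Lc c01]; have [xa xay] := fP a La a01.
  have [xc xcy] := fP c Lc c01.
  by rewrite (between_dist xay xcy) xa xc.
- have [] := fP 0 L0 _; first by rewrite lexx is_metric_ge0.
  by rewrite /seg_start /= => x0 _; apply/esym/is_metric_eq; rewrite x0.
- have [] := fP _ Lxy _; first by rewrite lexx is_metric_ge0.
  rewrite /seg_end /between /= => -> xy; apply/is_metric_eq; lra.
Qed.

Section SegmentFacts.
Variables (L : set R) (s : segment R X) (L0 : L 0).
Hypothesis (sS : is_segment L d s).

Lemma seg_dom0 : seg_dom L s 0.
Proof. by case: sS => _ l0 _; split; rewrite // lexx. Qed.

Lemma seg_dom_len : seg_dom L s (seg_len s).
Proof. by case: sS => Ll l0 _; split; rewrite // lexx l0. Qed.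

Lemma seg_dist a c : seg_dom L s a -> seg_dom L s c ->
  d (seg_path s a) (seg_path s c) = `|a - c|.
Proof. by case: sS => _ _; exact. Qed.

Lemma seg_dist_start a : seg_dom L s a -> d (seg_start s) (seg_path s a) = a.
Proof.
move=> sa; rewrite seg_dist//; last exact: seg_dom0.
by rewrite sub0r normrN ger0_norm//; case: sa => _ /andP[].
Qed.

Lemma seg_dist_end a : seg_dom L s a ->
  d (seg_path s a) (seg_end s) = seg_len s - a.
Proof.
move=> sa; rewrite seg_dist//; last exact: seg_dom_len.
by rewrite distrC ger0_norm// subr_ge0; case: sa => _ /andP[].
Qed.

Lemma seg_lenE : d (seg_start s) (seg_end s) = seg_len s.
Proof. exact/seg_dist_start/seg_dom_len. Qed.

Lemma seg_between a : seg_dom L s a ->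
  between (seg_start s) (seg_path s a) (seg_end s).
Proof.
move=> sa; rewrite /between seg_lenE seg_dist_start// seg_dist_end//; lra.
Qed.

End SegmentFacts.

Section TwoSegments.
Variables (L : set R) (s t : segment R X) (L0 : L 0).
Hypotheses (sS : is_segment L d s) (tS : is_segment L d t).
Hypothesis st0 : seg_start s = seg_start t.

Definition seg_gromov2 := gromov2 (seg_start s) (seg_end s) (seg_end t).
Local Notation G := seg_gromov2.

Lemma seg_gromov2_bounds : [/\ 0 <= G, G <= 2 * seg_len s & G <= 2 * seg_len t].
Proof.
split; first exact: gromov2_ge0.
  by rewrite -(seg_lenE L0 sS) gromov2_le.
by rewrite -(seg_lenE L0 tS) -st0 /G gromov2_sym gromov2_le.
Qed.

Lemma seg_agree a : seg_dom L s a -> seg_dom L t a -> 2 * a <= G ->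
  seg_path s a = seg_path t a.
Proof.
move=> sa ta ale.
apply: (@between_common (seg_start s) (seg_end s) (seg_end t)).
- exact: seg_between sa.
- by rewrite st0; exact: seg_between ta.
- by rewrite (seg_dist_start L0 sS sa) st0 (seg_dist_start L0 tS ta).
- by rewrite (seg_dist_start L0 sS sa).
Qed.

Lemma seg_apart a c : seg_dom L s a -> seg_dom L t c ->
  G <= 2 * a -> G <= 2 * c -> d (seg_path s a) (seg_path t c) = a + c - G.
Proof.
move=> sa tc ale cle.
rewrite (@dist_apart (seg_start s) (seg_end s) (seg_end t)).
- by rewrite (seg_dist_start L0 sS sa) st0 (seg_dist_start L0 tS tc) -st0.
- exact: seg_between sa.
- by rewrite st0; exact: seg_between tc.
- by rewrite (seg_dist_start L0 sS sa).
- by rewrite st0 (seg_dist_start L0 tS tc) -st0.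
Qed.

Lemma seg_agree_half a : L a -> 0 <= a -> 2 * a <= G ->
  seg_path s a = seg_path t a.
Proof.
move=> La a0 aG; have [_ Gs Gt] := seg_gromov2_bounds.
by apply: seg_agree => //; split=> //; apply/andP; split=> //; lra.
Qed.

Lemma same_germ_gromov2 : 0 < G -> same_germ L s t.
Proof.
move=> G0; have [_ Gs Gt] := seg_gromov2_bounds.
exists (2^-1 * G); split; [lra|lra|lra|] => a La ha.
by apply: seg_agree_half => //; lra.
Qed.

End TwoSegments.

Definition convex_metric := forall x y a, 0 <= a <= d x y ->
  exists z, d x z = a /\ between x z y.

Hypothesis dconv : convex_metric.

Lemma Rtree_segment x y : exists s : segment R X,
  [/\ is_segment setT d s, seg_start s = x, seg_end s = y &
    seg_len s = d x y].
Proof. by apply: segment_exists => // a _; exact: dconv. Qed.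

Lemma Rtree_seg_cat s t : is_segment setT d s -> is_segment setT d t ->
  seg_start s = seg_start t ->
  seg_image setT s `&` seg_image setT t = [set seg_start s] ->
  exists2 r, is_segment setT d r &
    seg_image setT r = seg_image setT s `|` seg_image setT t.
Proof.
move=> sS tS st0 stI.
have [G0 Gs Gt] := seg_gromov2_bounds (L := setT) I sS tS st0.
have {}G0 : seg_gromov2 s t = 0.
  have sG : seg_dom setT s (2^-1 * seg_gromov2 s t) by split=> //; lra.
  have tG : seg_dom setT t (2^-1 * seg_gromov2 s t) by split=> //; lra.
  have : (seg_image setT s `&` seg_image setT t)
           (seg_path s (2^-1 * seg_gromov2 s t)).
    split; first by exists (2^-1 * seg_gromov2 s t).
    exists (2^-1 * seg_gromov2 s t) => //.
    by apply/esym/(seg_agree _ sS tS) => //; lra.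
  rewrite stI /= => /(congr1 (d (seg_start s))).
  by rewrite (seg_dist_start _ sS)// is_metric_refl; lra.
have sl : 0 <= seg_len s by case: sS.
have tl : 0 <= seg_len t by case: tS.
pose p a := if a <= seg_len s then seg_path s (seg_len s - a)
            else seg_path t (a - seg_len s).
have stD a c : 0 <= a <= seg_len s -> 0 <= c <= seg_len t ->
    d (seg_path s a) (seg_path t c) = a + c.
  by move=> ha hc; rewrite (seg_apart _ sS tS)// G0 ?subr0//; lra.
exists (Segment (seg_len s + seg_len t) p).
  split=> //=; first lra.
  move=> a c [_ /=] ha [_ /=] hc; rewrite /p.
  case: (leP a) => as_; case: (leP c) => cs.
  + rewrite (seg_dist sS); [|by split=> //; lra|by split=> //; lra].
    by rewrite -normrN; congr `|_|; ring.
  + by rewrite stD ?ltr0_norm; lra.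
  + by rewrite is_metric_sym stD ?gtr0_norm; lra.
  + rewrite (seg_dist tS); [|by split=> //; lra|by split=> //; lra].
    by congr `|_|; ring.
apply/seteqP; split=> x.
  case=> a [_ /=] ha <-; rewrite /p; case: leP => as_.
    by left; exists (seg_len s - a) => //; split=> //; lra.
  by right; exists (a - seg_len s) => //; split=> //; lra.
case=> -[a [_ /=] ha <-].
  exists (seg_len s - a); first by split=> //=; lra.
  by rewrite /= /p lerBlDr lerDl (andP ha).1 subKr.
exists (seg_len s + a); first by split=> //=; lra.
rewrite /= /p; case: leP => as_; last by rewrite addrC addKr.
have -> : a = 0 by lra.
by rewrite addr0 subrr -/(seg_start s) st0.
Qed.

Lemma Rtree_seg_meet s t : is_segment setT d s -> is_segment setT d t ->
  seg_start s = seg_start t ->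
  exists2 r, is_segment setT d r &
    seg_image setT r = seg_image setT s `&` seg_image setT t.
Proof.
move=> sS tS st0; have [G0 Gs Gt] := seg_gromov2_bounds (L := setT) I sS tS st0.
exists (Segment (2^-1 * seg_gromov2 s t) (seg_path s)).
  split=> //=; first lra.
  by move=> a c [_ /=] ha [_ /=] hc; rewrite (seg_dist sS)//; split=> //; lra.
apply/seteqP; split=> x.
  case=> a [_ /=] ha <-; split; exists a => //; try by split=> //; lra.
  by apply/esym/(seg_agree_half _ sS tS st0) => //; lra.
case=> -[a [_ /=] ha <-] [c [_ /=] hc tcsa].
exists a => //; split=> //=; apply/andP; split; first lra.
have sa : seg_dom setT s a by [].
have tc : seg_dom setT t c by [].
rewrite leNgt; apply/negP => Ga.
have ac : a = c.
  rewrite -(seg_dist_start _ sS sa)// -tcsa st0.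
  by rewrite (seg_dist_start _ tS).
have := @seg_apart setT s t I sS tS st0 a c sa tc.
by rewrite tcsa is_metric_refl -ac => /(_ _ _)/wrap[]; lra.
Qed.

Lemma Rtree_four_point : is_Rtree d.
Proof.
split=> //; [|exact: Rtree_seg_cat|exact: Rtree_seg_meet].
by move=> x y; have [s [? ? ? _]] := Rtree_segment x y; exists s.
Qed.

End FourPoint.

(** * Completion of segments *)

Section SeparatedQuotientFacts.
Variables (R : realType) (T : Type) (d : T -> T -> R).
Hypotheses (drefl : forall x, d x x = 0) (dsym : forall x y, d x y = d y x)
  (dtri : forall x y z, d x z <= d x y + d y z).

Lemma pseudo_congr x y x' y' : d x x' = 0 -> d y y' = 0 -> d x y = d x' y'.
Proof.
move=> xx' yy'; apply/eqP; rewrite eq_le.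
have := dtri x' x y'; have := dtri x y y'; have := dtri x x' y.
have := dtri x' y' y; have := dsym x x'; have := dsym y y'.
by move=> *; apply/andP; split; lra.
Qed.

Lemma sep_pi_eq x y : sep_pi d x = sep_pi d y <-> d x y = 0.
Proof.
split=> [[]|xy].
  by move=> /(congr1 (fun A : set T => A y)) /=; rewrite drefl => ->.
suff e : [set z | d x z = 0] = [set z | d y z = 0].
  by apply: eq_exist.
by apply/funext => z /=; rewrite (@pseudo_congr x z y z).
Qed.

Lemma sep_pi_surj A : exists x, A = sep_pi d x.
Proof. by case: A => A [x Ax]; exists x; apply: eq_exist. Qed.

Lemma sep_repr_pi x : d x (sep_repr (sep_pi d x)) = 0.
Proof.
rewrite /sep_repr; case: cid => /= y.
by move=> /(congr1 (fun A : set T => A y)) /=; rewrite drefl => ->.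
Qed.

Lemma sep_distE x y : sep_dist (sep_pi d x) (sep_pi d y) = d x y.
Proof. by apply/esym/pseudo_congr; exact: sep_repr_pi. Qed.

Lemma sep_is_metric : is_metric (@sep_dist R T d).
Proof.
split=> A B; have [x ->] := sep_pi_surj A; have [y ->] := sep_pi_surj B.
- by rewrite sep_distE sep_pi_eq.
- by rewrite !sep_distE.
- by move=> C; have [z ->] := sep_pi_surj C; rewrite !sep_distE.
Qed.

Lemma sep_four_point : four_point d -> four_point (@sep_dist R T d).
Proof.
move=> d4 A B C D; have [x ->] := sep_pi_surj A; have [y ->] := sep_pi_surj B.
have [z ->] := sep_pi_surj C; have [w ->] := sep_pi_surj D.
by rewrite !sep_distE.
Qed.

End SeparatedQuotientFacts.

Section Completion.
Variables (R : realType) (L : set R) (X : Type) (d : X -> X -> R).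
Hypotheses (L0 : L 0) (LB : forall a c, L a -> L c -> L (a - c))
  (Lhalf : forall a, L a -> L (2^-1 * a))
  (Lsmall : forall e, 0 < e -> exists2 a, L a & 0 < a < e).
Hypotheses (dM : is_metric d) (d4 : four_point d) (dL : forall x y, L (d x y)).
Hypothesis dconv : forall x y a, L a -> 0 <= a <= d x y ->
  exists z, d x z = a /\ between d x z y.

Local Notation SS := (segSequence L d).
Local Notation D := (@seg_seq_dist R L X d).
Local Notation Y := (segCompletion L d).
Local Notation dY := (@segCompletion_dist R L X d).

Lemma L_natmul a n : L a -> L (n%:R * a).
Proof.
move=> La; elim: n => [|n IH]; first by rewrite mul0r.
have -> : n.+1%:R * a = n%:R * a - (0 - a) by rewrite -natr1; ring.
by apply: LB => //; exact: LB.
Qed.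

Lemma L_approx (r e : R) : 0 <= r -> 0 < e ->
  exists2 a, L a & 0 <= a /\ r - e < a <= r.
Proof.
move=> r0 /Lsmall[u Lu /andP[u0 ue]].
exists ((Num.truncn (r / u))%:R * u); first exact: L_natmul.
have /andP[] : (Num.truncn (r / u))%:R <= r / u < (Num.truncn (r / u)).+1%:R.
  by rewrite truncn_itv// divr_ge0// ltW.
rewrite ler_pdivlMr// ltr_pdivrMr// -natr1 mulrDl mul1r => le lt.
by split; [rewrite mulr_ge0// ltW|rewrite le andbT; lra].
Qed.

Lemma seg_exists_L x y : exists s : segment R X,
  [/\ is_segment L d s, seg_start s = x, seg_end s = y & seg_len s = d x y].
Proof. by apply: segment_exists => // a; exact: dconv. Qed.

Lemma seg_seq_dist_cvg (u v : SS) : (fun n => d (u n) (v n)) @ \oo --> D u v.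
Proof.
apply: cauchy_cvg; apply: cauchy_exP => e e0.
have e20 : 0 < e / 2 by rewrite divr_gt0.
have [N uN] := seg_seq_cauchy u e20; have [M vM] := seg_seq_cauchy v e20.
exists (d (u (N + M)%N) (v (N + M)%N)).
exists (N + M)%N => //= n /= nNM; rewrite /ball /=.
have := uN (N + M)%N n (leq_addr _ _) (leq_trans (leq_addr _ _) nNM).
have := vM (N + M)%N n (leq_addl _ _) (leq_trans (leq_addl _ _) nNM).
move: (u (N + M)%N) (v (N + M)%N) (u n) (v n) => a b a' b' bb' aa'.
have := is_metric_tri dM a a' b; have := is_metric_tri dM a' b' b.
have := is_metric_tri dM a' a b'; have := is_metric_tri dM a b b'.
have := is_metric_sym dM a a'; have := is_metric_sym dM b b' => *.
by rewrite ltr_norml; apply/andP; split; lra.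
Qed.

Lemma seg_seq_dist_near (u v : SS) (e : R) : 0 < e ->
  \forall n \near \oo, `|D u v - d (u n) (v n)| < e.
Proof. by move: e; apply/cvgrPdist_lt; exact: seg_seq_dist_cvg. Qed.

Lemma seg_seq_dist_refl u : D u u = 0.
Proof.
rewrite /seg_seq_dist (_ : (fun n => d (u n) (u n)) = cst 0) ?lim_cst//.
by apply/funext => n; rewrite is_metric_refl.
Qed.

Lemma seg_seq_dist_sym u v : D u v = D v u.
Proof.
rewrite /seg_seq_dist.
rewrite (_ : (fun n => d (u n) (v n)) = (fun n => d (v n) (u n)))//.
by apply/funext => n; exact: is_metric_sym.
Qed.

Lemma seg_seq_dist_tri u v w : D u w <= D u v + D v w.
Proof.
apply/ler_addgt0Pl => e e0; have e3 : 0 < e / 3 by rewrite divr_gt0.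
near \oo => n.
have : `|D u w - d (u n) (w n)| < e / 3 by near: n; exact: seg_seq_dist_near.
have : `|D u v - d (u n) (v n)| < e / 3 by near: n; exact: seg_seq_dist_near.
have : `|D v w - d (v n) (w n)| < e / 3 by near: n; exact: seg_seq_dist_near.
rewrite !ltr_norml; have := is_metric_tri dM (u n) (v n) (w n); lra.
Unshelve. all: by end_near. Qed.

Lemma seg_seq_dist_four_point : four_point D.
Proof.
move=> x y z w.
apply/ler_addgt0Pl => e e0; have e4 : 0 < e / 4 by rewrite divr_gt0.
near \oo => n.
have : `|D x y - d (x n) (y n)| < e / 4 by near: n; exact: seg_seq_dist_near.
have : `|D z w - d (z n) (w n)| < e / 4 by near: n; exact: seg_seq_dist_near.
have : `|D x z - d (x n) (z n)| < e / 4 by near: n; exact: seg_seq_dist_near.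
have : `|D y w - d (y n) (w n)| < e / 4 by near: n; exact: seg_seq_dist_near.
have : `|D x w - d (x n) (w n)| < e / 4 by near: n; exact: seg_seq_dist_near.
have : `|D y z - d (y n) (z n)| < e / 4 by near: n; exact: seg_seq_dist_near.
rewrite !ltr_norml; have := four_pointP d4 (x n) (y n) (z n) (w n).
by move=> [] ? *; rewrite -lerBlDl le_max; apply/orP; [left|right]; lra.
Unshelve. all: by end_near. Qed.

Lemma completion_is_metric : is_metric dY.
Proof.
apply: sep_is_metric; first exact: seg_seq_dist_refl.
  exact: seg_seq_dist_sym.
exact: seg_seq_dist_tri.
Qed.

Lemma completion_four_point : four_point dY.
Proof.
apply: sep_four_point; last exact: seg_seq_dist_four_point.
- exact: seg_seq_dist_refl.
- exact: seg_seq_dist_sym.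
- exact: seg_seq_dist_tri.
Qed.

Lemma completion_distE u v : dY (sep_pi D u) (sep_pi D v) = D u v.
Proof.
apply: sep_distE; [exact: seg_seq_dist_refl|exact: seg_seq_dist_sym|].
exact: seg_seq_dist_tri.
Qed.

Variable incl : X -> Y.
Hypothesis incl_const : forall p, exists2 u : SS,
  forall n, u n = p & incl p = sep_pi D u.

Local Notation YM := completion_is_metric.
Local Notation Y4 := completion_four_point.

Lemma incl_dist p q : dY (incl p) (incl q) = d p q.
Proof.
have [u up ->] := incl_const p; have [v vq ->] := incl_const q.
rewrite completion_distE /seg_seq_dist.
rewrite (_ : (fun n => d (u n) (v n)) = cst (d p q)) ?lim_cst//.
by apply/funext => n; rewrite up vq.
Qed.

Lemma incl_inj p q : incl p = incl q -> p = q.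
Proof.
move=> pq; apply/(is_metric_eq dM).
by rewrite -incl_dist pq (is_metric_refl YM).
Qed.

Lemma incl_dist_near p (u : SS) (e : R) : 0 < e ->
  \forall n \near \oo, `|dY (incl p) (sep_pi D u) - d p (u n)| < e.
Proof.
move=> e0; have [v vp ->] := incl_const p; rewrite completion_distE.
by apply: filterS (@seg_seq_dist_near v u e e0) => n; rewrite vp.
Qed.

Lemma completion_on_segment p P :
  exists b, between dY (incl p) P (incl b).
Proof.
have [u ->] := sep_pi_surj P.
have [s sS us] := seg_seq_in u.
have xuy n : between d (seg_start s) (u n) (seg_end s).
  by have [a sa <-] := us n; apply: seg_between sa.
move: (seg_start s) (seg_end s) xuy => x y xuy.
have xPy : between dY (incl x) (sep_pi D u) (incl y).
  rewrite /between incl_dist (is_metric_sym YM (sep_pi D u)).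
  apply/eqP; rewrite eq_le; apply/andP; split; last first.
    by have := is_metric_tri YM (incl x) (sep_pi D u) (incl y);
       rewrite incl_dist (is_metric_sym YM (sep_pi D u)).
  apply/ler_addgt0Pl => e e0; have e2 : 0 < e / 2 by rewrite divr_gt0.
  near \oo => n.
  have : `|dY (incl x) (sep_pi D u) - d x (u n)| < e / 2.
    by near: n; exact: incl_dist_near.
  have : `|dY (incl y) (sep_pi D u) - d y (u n)| < e / 2.
    by near: n; exact: incl_dist_near.
  rewrite !ltr_norml; have := xuy n; rewrite /between.
  have := is_metric_sym dM y (u n); lra.
move: (sep_pi D u) xPy => Q xQy.
have /(between_gromov2_0 YM) := xQy.
have := gromov2_min YM Y4 Q (incl x) (incl p) (incl y).
have := gromov2_ge0 YM Q (incl x) (incl p).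
have := gromov2_ge0 YM Q (incl p) (incl y).
move=> ? ? h xy0; case: h => h; [exists x|exists y].
  by apply/(between_gromov2_0 YM); rewrite (gromov2_sym YM); lra.
by apply/(between_gromov2_0 YM); lra.
Unshelve. all: by end_near. Qed.

Lemma completion_point p b r : 0 <= r <= d p b ->
  exists P, dY (incl p) P = r /\ between dY (incl p) P (incl b).
Proof.
move=> /andP[r0 rb]; have [s [sS s0 s1 sl]] := seg_exists_L p b.
have /choice[a aP] : forall n : nat, exists a, [/\ L a, 0 <= a &
    r - n.+1%:R^-1 < a <= r].
  move=> n; have [|a La []] := @L_approx r n.+1%:R^-1 r0 _; last by exists a.
  by rewrite invr_gt0.
have sa n : seg_dom L s (a n).
  by have [La a0 /andP[_ ar]] := aP n; split; rewrite // a0 sl (le_trans ar).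
have acvg e : 0 < e -> exists N, forall n, (N <= n)%N -> r - e < a n <= r.
  move=> e0; exists (Num.truncn e^-1) => n Nn.
  have [_ _ /andP[ra ->]] := aP n; rewrite andbT (le_lt_trans _ ra)//.
  rewrite lerB// -[leRHS]invrK lef_pV2 ?posrE ?invr_gt0//.
  by rewrite ltW// (lt_le_trans (truncnS_gt _))// ler_nat ltnS.
have Pin : exists2 t, is_segment L d t &
    forall n, seg_image L t (seg_path s (a n)).
  by exists s => // n; exists (a n).
have Pcauchy e : 0 < e -> exists N, forall m n, (N <= m)%N -> (N <= n)%N ->
    d (seg_path s (a m)) (seg_path s (a n)) < e.
  move=> /acvg[N aN]; exists N => m n /aN ? /aN ?; rewrite (seg_dist sS)//.
  by rewrite ltr_norml; lra.
pose u : SS := @SegSequence R L X d (fun n => seg_path s (a n)) Pin Pcauchy.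
have dP q f : (forall n, d q (u n) = f (a n)) ->
    (forall n, `|f (a n) - f r| <= `|a n - r|) ->
    dY (incl q) (sep_pi D u) = f r.
  move=> fE flip; apply/eqP; rewrite -subr_eq0 -normr_le0.
  apply/ler_addgt0Pl => e e0; have e2 : 0 < e / 2 by rewrite divr_gt0.
  have [N aN] := acvg _ e2; rewrite addr0.
  near \oo => n.
  have : `|dY (incl q) (sep_pi D u) - d q (u n)| < e / 2.
    by near: n; exact: incl_dist_near.
  have /aN : (N <= n)%N by near: n; exists N.
  rewrite fE => ?; have := flip n; rewrite [X in _ <= X]ler0_norm; last lra.
  move=> h1 /ltW h2.
  have := ler_normD (dY (incl q) (sep_pi D u) - f (a n)) (f (a n) - f r).
  by rewrite addrA subrK; lra.
exists (sep_pi D u).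
have Pr : dY (incl p) (sep_pi D u) = r.
  apply: (dP p id) => // n.
  by rewrite -s0 (seg_dist_start L0 sS).
split=> //; rewrite /between Pr (is_metric_sym YM) (dP b (fun a => d p b - a)).
- by rewrite incl_dist; lra.
- by move=> n; rewrite -s1 (is_metric_sym dM) (seg_dist_end sS)// sl s1.
- by move=> n; rewrite distrC opprB addrC addrA subrK distrC.
Unshelve. all: by end_near. Qed.

Lemma incl_of_value p b P : between dY (incl p) P (incl b) ->
  L (dY (incl p) P) -> exists q, P = incl q.
Proof.
move=> pPb Lr.
have [|q [pq pqb]] := dconv (x := p) (y := b) Lr.
  rewrite (is_metric_ge0 YM) /=.
  by rewrite -incl_dist -pPb lerDl (is_metric_ge0 YM).
exists q; apply: (between_inj YM Y4 pPb); last by rewrite incl_dist.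
by rewrite /between !incl_dist.
Qed.

Lemma incl_dense P (e : R) : 0 < e -> exists p, dY P (incl p) < e.
Proof.
move=> e0; have [p0 _] : exists p : X, True.
  by have [u _] := sep_pi_surj P; exists (u 0%N).
have [b pPb] := completion_on_segment p0 P.
have [|a La [a0 /andP[ea ar]]] := @L_approx (dY (incl p0) P) e _ e0.
  exact: (is_metric_ge0 YM).
have rb : dY (incl p0) P <= d p0 b.
  by rewrite -incl_dist -pPb lerDl (is_metric_ge0 YM).
have [|q [pq pqb]] := dconv (x := p0) (y := b) La; first lra.
exists q; have pqb' : between dY (incl p0) (incl q) (incl b).
  by rewrite /between !incl_dist.
by rewrite (between_dist YM Y4 pPb pqb') incl_dist pq ltr_norml; lra.
Qed.

Lemma common_segment P Q : exists x y,
  between dY (incl x) P (incl y) /\ between dY (incl x) Q (incl y).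
Proof.
have [p _] : exists p : X, True by have [u _] := sep_pi_surj P; exists (u 0%N).
have [b pPb] := completion_on_segment p P.
have [c pQc] := completion_on_segment p Q.
set G := gromov2 dY (incl p) (incl b) (incl c).
have [PG|GP] := leP (2 * dY (incl p) P) G.
  by exists p, c; split=> //; exact: (between_switch YM Y4 pPb PG).
have [QG|GQ] := leP (2 * dY (incl p) Q) G.
  exists p, b; split=> //; apply: (between_switch YM Y4 pQc).
  by rewrite (gromov2_sym YM).
exists b, c; split; rewrite /between.
  have pcc : between dY (incl p) (incl c) (incl c).
    by rewrite /between (is_metric_refl YM) addr0.
  have cG : G <= 2 * dY (incl p) (incl c).
    by rewrite /G (gromov2_sym YM) (gromov2_le YM).
  rewrite (dist_apart YM Y4 pPb pcc _ cG); last exact: ltW.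
  have := pPb; have := is_metric_sym YM (incl b) P.
  by rewrite /G /gromov2 /between; lra.
have pbb : between dY (incl p) (incl b) (incl b).
  by rewrite /between (is_metric_refl YM) addr0.
have bG : G <= 2 * dY (incl p) (incl b) by exact: (gromov2_le YM).
rewrite (dist_apart YM Y4 pbb pQc bG); last exact: ltW.
by have := pQc; rewrite /G /gromov2 /between; lra.
Qed.

Lemma completion_convex : convex_metric dY.
Proof.
move=> P Q a /andP[a0 aPQ].
have [x [y [xPy xQy]]] : exists x y, [/\ between dY (incl x) P (incl y),
    between dY (incl x) Q (incl y) & dY (incl x) P <= dY (incl x) Q].
  have [x [y [xPy xQy]]] := common_segment P Q.
  have [PQ|QP] := leP (dY (incl x) P) (dY (incl x) Q); first by exists x, y.
  exists y, x; split; [exact: (between_sym YM)|exact: (between_sym YM)|].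
  have := xPy; have := xQy.
  rewrite /between !(is_metric_sym YM _ (incl y)); lra.
move=> PQ; have PQE := between_dist YM Y4 xPy xQy.
have {}PQE : dY P Q = dY (incl x) Q - dY (incl x) P.
  by rewrite PQE distrC ger0_norm// subr_ge0.
have P0 := is_metric_ge0 YM (incl x) P.
have Qy := is_metric_ge0 YM Q (incl y).
have [|Z [xZ xZy]] := @completion_point x y (dY (incl x) P + a).
  by rewrite -incl_dist -xQy; lra.
have ZPE := between_dist YM Y4 xPy xZy; have ZQE := between_dist YM Y4 xZy xQy.
rewrite xZ in ZPE ZQE.
exists Z; rewrite /between ZPE ZQE PQE.
by rewrite ler0_norm ?ler0_norm; [split|..]; lra.
Qed.

Lemma completion_Rtree : is_Rtree dY.
Proof.
by apply: Rtree_four_point; [exact: YM|exact: Y4|exact: completion_convex].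
Qed.

Lemma two_germs P : ~ (exists p, incl p = P) ->
  (germs setT dY P #= `I_2)%card.
Proof.
move=> nP; have [x [y [xPy _]]] := common_segment P P.
have Pgt0 q : 0 < dY P (incl q).
  rewrite lt_neqAle (is_metric_ge0 YM) andbT; apply/eqP => P0.
  by apply: nP; exists q; apply/esym/(is_metric_eq YM); rewrite -P0.
have segP q : exists s : segment R Y, [/\ nondeg_segment setT dY s,
    seg_start s = P & seg_end s = incl q].
  have [s [sS s0 s1 sl]] := Rtree_segment YM Y4 completion_convex P (incl q).
  by exists s; split=> //; split=> //; rewrite sl.
have [S1 [S1n S1P S1x]] := segP x; have [S2 [S2n S2P S2y]] := segP y.
have [S1S _] := S1n; have [S2S _] := S2n.
have S12 : seg_start S1 = seg_start S2 by rewrite S1P.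
have /(between_gromov2_0 YM) G12 := xPy.
have neq : germ setT dY S1 <> germ setT dY S2.
  move=> /(germ_eq _ S2n)[e [e0 e1 e2 eqe]].
  have := @seg_apart _ _ _ YM Y4 setT S1 S2 I S1S S2S S12 (e / 2) (e / 2).
  rewrite /seg_gromov2 S1P S1x S2y G12 eqe//; last by lra.
  rewrite (is_metric_refl YM).
  have h1 : seg_dom setT S1 (e / 2) by split=> //; lra.
  have h2 : seg_dom setT S2 (e / 2) by split=> //; lra.
  have h3 : 0 <= 2 * (e / 2) by lra.
  by move=> /(_ h1 h2 h3 h3); lra.
have -> : germs setT dY P = [set germ setT dY S1; germ setT dY S2].
  apply/seteqP; split=> c; last first.
    by move=> [] ->; [exists S1|exists S2].
  move=> [S [Sn SP] <-]; have [SS' Sl] := Sn.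
  suff [G0|G0] : 0 < seg_gromov2 dY S S1 \/ 0 < seg_gromov2 dY S S2.
  - left; apply/(germ_eq _ S1n).
    apply: (same_germ_gromov2 YM Y4 _ SS' S1S _ G0) => //.
    by rewrite SP.
  - right; apply/(germ_eq _ S2n).
    apply: (same_germ_gromov2 YM Y4 _ SS' S2S _ G0) => //.
    by rewrite SP.
  rewrite /seg_gromov2 SP S1x S2y.
  move: (seg_end S) (seg_lenE (L := setT) I SS').
  rewrite SP => Q PQ.
  apply: contrapT => /not_orP[/negP + /negP]; rewrite -!leNgt => Gx Gy.
  have [q Qq] := incl_dense Q Sl.
  have Qq0 : 0 < gromov2 dY P Q (incl q).
    by rewrite /gromov2 PQ; have := Pgt0 q; lra.
  have xq0 : gromov2 dY P (incl x) (incl q) = 0.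
    have := gromov2_min YM Y4 P (incl x) (incl q) Q.
    have := gromov2_min YM Y4 P Q (incl q) (incl x).
    have := gromov2_ge0 YM P (incl x) (incl q).
    have := gromov2_sym YM P Q (incl x); have := gromov2_sym YM P Q (incl q).
    have := gromov2_sym YM P (incl x) (incl q).
    by move=> ? ? ? ? [] ? [] ?; lra.
  have yq0 : gromov2 dY P (incl y) (incl q) = 0.
    have := gromov2_min YM Y4 P (incl y) (incl q) Q.
    have := gromov2_min YM Y4 P Q (incl q) (incl y).
    have := gromov2_ge0 YM P (incl y) (incl q).
    have := gromov2_sym YM P Q (incl y); have := gromov2_sym YM P Q (incl q).
    have := gromov2_sym YM P (incl y) (incl q).
    by move=> ? ? ? ? [] ? [] ?; lra.
  apply: nP; have [|r ->] := incl_of_value xPy; last by exists r.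
  have -> : dY (incl x) P = 2^-1 * (d x y - (d y q - d x q)).
    rewrite -!incl_dist; move: G12 xq0 yq0; rewrite /gromov2.
    by have := is_metric_sym YM P (incl x); lra.
  by apply: Lhalf; apply: (LB _ (LB _ _)).
exact: card_eq_set2.
Qed.

(* [restrict_germ] is the case [incl := tree_incl]. *)
Definition restrict_along (c : set (segment R Y)) : set (segment R X) :=
  [set s | nondeg_segment L d s /\
     exists2 S, c S & exists e, [/\ 0 < e, e <= seg_len s, e <= seg_len S &
       forall a, L a -> 0 <= a < e -> seg_path S a = incl (seg_path s a)]].

Lemma restrict_germ_along p (S : segment R Y) :
  nondeg_segment setT dY S -> seg_start S = incl p ->
  exists s, [/\ nondeg_segment L d s, seg_start s = p,
    restrict_along (germ setT dY S) = germ L d s &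
    exists e, [/\ 0 < e, e <= seg_len s, e <= seg_len S &
       forall a, L a -> 0 <= a < e -> seg_path S a = incl (seg_path s a)]].
Proof.
move=> Sn Sp; have [SS' Sl] := Sn.
have [b pQb] := completion_on_segment p (seg_end S).
have [s [sS s0 s1 sl]] := seg_exists_L p b.
have Ssl : seg_len S <= seg_len s.
  rewrite sl -incl_dist -pQb -(seg_lenE (L := setT) I SS') Sp lerDl.
  exact: (is_metric_ge0 YM).
have sn : nondeg_segment L d s by split=> //; exact: lt_le_trans Ssl.
have agree a : L a -> 0 <= a < seg_len S -> seg_path S a = incl (seg_path s a).
  move=> La /andP[a0 aS].
  have Sa : seg_dom setT S a by split=> //; rewrite a0 ltW.
  have sa : seg_dom L s a by split=> //; rewrite a0 (le_trans (ltW aS)).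
  have SaE := seg_dist_start (L := setT) I SS' Sa.
  have saE := seg_dist_start L0 sS sa.
  apply: (@between_inj _ _ _ YM Y4 (incl p) (incl b)).
  - by apply: (between_trans YM _ pQb); rewrite -Sp; apply: seg_between Sa.
  - by have := seg_between L0 sS sa; rewrite /between s0 s1 !incl_dist.
  - by rewrite incl_dist -{1}Sp SaE -s0 saE.
have ex : exists e, [/\ 0 < e, e <= seg_len s, e <= seg_len S &
    forall a, L a -> 0 <= a < e -> seg_path S a = incl (seg_path s a)].
  by exists (seg_len S).
exists s; split=> //; apply/seteqP; split=> t.
  move=> [tn [S' [S'n [f [f0 fS fS' SS'f]]] [e [e0 et eS' S't]]]]; split=> //.
  exists (Num.min e f); split.
  - by rewrite lt_min e0.
  - by rewrite ge_min (le_trans fS Ssl) orbT.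
  - by rewrite ge_min et.
  - move=> a La /andP[a0]; rewrite lt_min => /andP[ae af]; apply: incl_inj.
    by rewrite -agree ?a0 ?(lt_le_trans af)// -S't ?a0// SS'f ?a0.
move=> [tn [e [e0 es et st]]]; split=> //; exists S; first exact: germ_refl.
exists (Num.min e (seg_len S)); split.
- by rewrite lt_min e0.
- by rewrite ge_min et.
- by rewrite ge_min lexx orbT.
- move=> a La /andP[a0]; rewrite lt_min => /andP[ae aS].
  by rewrite agree ?a0// st ?a0.
Qed.

Lemma restrict_along_germs p c :
  germs setT dY (incl p) c -> germs L d p (restrict_along c).
Proof.
move=> [S [Sn Sp] <-]; have [s [sn s0 -> _]] := restrict_germ_along Sn Sp.
by exists s.
Qed.

Lemma restrict_along_inj p c1 c2 : germs setT dY (incl p) c1 ->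
  germs setT dY (incl p) c2 -> restrict_along c1 = restrict_along c2 ->
  c1 = c2.
Proof.
move=> [S [Sn Sp] <-] [T [Tn Tp] <-].
have [s [sn s0 -> [e [e0 es eS Ss]]]] := restrict_germ_along Sn Sp.
have [t [tn t0 -> [f [f0 ft fT Tt]]]] := restrict_germ_along Tn Tp.
move=> /(germ_eq _ tn)[g [g0 gs gt st]]; apply/(germ_eq _ Tn).
pose m := Num.min e (Num.min f g).
exists m; split; rewrite /m ?lt_min ?ge_min ?e0 ?f0 ?g0 ?eS ?fT ?orbT//.
move=> r _ /andP[r0]; rewrite !lt_min => /and3P[re rf rg].
apply: (is_metric_eq YM); apply/ler_addgt0Pl => k k0.
have k2 : 0 < k / 2 by rewrite divr_gt0.
have [a La [a0 /andP[ka ar]]] := L_approx r0 k2.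
have ST : seg_path S a = seg_path T a.
  by rewrite Ss ?Tt ?st//; lra.
have [SS' _] := Sn; have [TS _] := Tn.
have := is_metric_tri YM (seg_path S r) (seg_path S a) (seg_path T r).
have [Sr Sa] : seg_dom setT S r /\ seg_dom setT S a by split; split=> //; lra.
have [Tr Ta] : seg_dom setT T r /\ seg_dom setT T a by split; split=> //; lra.
rewrite (seg_dist SS' Sr Sa) ST (seg_dist TS Ta Tr).
by rewrite ger0_norm ?ler0_norm; lra.
Qed.

Lemma cyclic_order_restrict p o : cyclic_order (germs L d p) o ->
  cyclic_order (germs setT dY (incl p))
    (fun a b c => o (restrict_along a) (restrict_along b) (restrict_along c)).
Proof.
apply: cyclic_order_pullback; first exact: restrict_along_germs.
exact: restrict_along_inj.
Qed.

End Completion.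

(** * Valuation *)

Section LogFacts.
Variables (R : realType) (F : rcfType) (beta : bigElement F).
Local Notation b := (big_val beta).
Local Notation log := (logb R beta).

Lemma big_floor (x : F) : 0 < x -> exists m : int, b ^ m <= x < b ^ (m + 1).
Proof.
move=> x0; have [k xk] := big_dom beta x; have [l xl] := big_dom beta x^-1.
have ex : exists j : nat, x < b ^ (j%:Z - l%:Z).
  by exists (k + l)%N; rewrite PoszD addrK.
case: (ex_minnP ex) => -[|j] xj jmin.
  move: xj; rewrite sub0r -invr_expz -exprnP => xj.
  have b0 := big_gt0 beta.
  suff : b ^+ l < x^-1 by move=> /(lt_trans xl); rewrite ltxx.
  by rewrite -[b ^+ l]invrK ltf_pV2 ?posrE ?invr_gt0 ?exprn_gt0.
exists (j%:Z - l%:Z); rewrite leNgt; apply/andP; split.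
  by apply/negP => /jmin; rewrite ltnn.
by have -> : j%:Z - l%:Z + 1 = j.+1%:Z - l%:Z by rewrite -addn1 PoszD; ring.
Qed.

Lemma logb_ge (h : F) (m : int) n : 0 < h -> (0 < n)%N -> b ^ m <= h ^+ n ->
  m%:~R / n%:R <= log h.
Proof.
move=> h0 n0 mn; apply: ub_le_sup; first by case: (has_sup_log_cut R beta h0).
by exists m, n.
Qed.

Lemma logb_lt (h : F) (m : int) n : 0 < h -> (0 < n)%N -> h ^+ n < b ^ m ->
  log h <= m%:~R / n%:R.
Proof.
move=> h0 n0 mn; apply: ge_sup; first by case: (has_sup_log_cut R beta h0).
move=> _ [p [q [q0 pq ->]]].
rewrite ler_pdivrMr ?ltr0n// mulrAC ler_pdivlMr ?ltr0n//.
rewrite -[n%:R]/(n%:Z%:~R) -[q%:R]/(q%:Z%:~R) -!intrM ler_int.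
rewrite -(big_expz_mono beta) -!exprz_exp -!exprnP.
apply: (@le_trans _ _ ((h ^+ n) ^+ q)).
  rewrite [leRHS]exprAC lerXn2r ?nnegrE ?exprn_ge0// ?ltW//.
  by rewrite exprz_gt0// big_gt0.
by rewrite lerXn2r ?nnegrE ?exprn_ge0 ?exprz_ge0// ltW// big_gt0.
Qed.

Lemma logbM (h k : F) : 0 < h -> 0 < k -> log (h * k) = log h + log k.
Proof.
move=> h0 k0; have hk0 : 0 < h * k by rewrite mulr_gt0.
have close n : (0 < n)%N -> `|log (h * k) - (log h + log k)| <= 2 / n%:R.
  move=> n0; have n0' : 0 < n%:R :> R by rewrite ltr0n.
  have [m /andP[mh hm]] := big_floor (exprn_gt0 n h0).
  have [p /andP[pk kp]] := big_floor (exprn_gt0 n k0).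
  have := logb_ge h0 n0 mh; have := logb_lt h0 n0 hm.
  have := logb_ge k0 n0 pk; have := logb_lt k0 n0 kp.
  have b0 := big_gt0 beta.
  have : b ^ (m + p) <= (h * k) ^+ n.
    by rewrite exprMn expfzDr ?gt_eqF// ler_pM// ?exprz_ge0// ltW.
  have : (h * k) ^+ n < b ^ (m + 1 + (p + 1)).
    by rewrite exprMn expfzDr ?gt_eqF// ltr_pM// exprn_ge0// ltW.
  move=> /(logb_lt hk0 n0) + /(logb_ge hk0 n0).
  rewrite !intrD !mulrDl !mul1r ler_norml => *.
  by apply/andP; split; lra.
apply/eqP; rewrite -subr_eq0 -normr_le0; apply/ler_addgt0Pl => e e0.
rewrite addr0; apply: le_trans (close (Num.truncn (2 / e)).+1 isT) _.
rewrite ler_pdivrMr ?ltr0n// mulrC -ler_pdivrMr//.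
exact/ltW/truncnS_gt.
Qed.

Lemma logbV (h : F) : 0 < h -> log h^-1 = - log h.
Proof.
move=> h0; apply/eqP; rewrite -addr_eq0 addrC -logbM ?invr_gt0//.
by rewrite mulfV ?logb1 ?eqxx ?gt_eqF.
Qed.

Lemma logb_div (h k : F) : 0 < h -> 0 < k -> log (h / k) = log h - log k.
Proof. by move=> h0 k0; rewrite logbM ?invr_gt0// logbV. Qed.

Lemma ler_logb (h k : F) : 0 < h -> h <= k -> log h <= log k.
Proof.
move=> h0 hk; have k0 := lt_le_trans h0 hk.
rewrite -subr_le0 -logb_div//; apply/logb_le0P; first by rewrite divr_gt0.
move=> n; apply: le_lt_trans (big_gt1 beta).
by apply: exprn_ile1; [rewrite divr_ge0 ?ltW|rewrite ler_pdivrMr ?mul1r].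
Qed.

Lemma logbX (h : F) n : 0 < h -> log (h ^+ n) = n%:R * log h.
Proof.
move=> h0; elim: n => [|n IH]; first by rewrite expr0 logb1 mul0r.
by rewrite exprS logbM ?exprn_gt0// IH -natr1; ring.
Qed.

Lemma logb_big : log b = 1.
Proof.
have b0 := big_gt0 beta; apply/eqP; rewrite eq_le; apply/andP; split.
  apply: ge_sup; first by case: (has_sup_log_cut R beta b0).
  move=> _ [m [n [n0 mn ->]]]; rewrite ler_pdivrMr ?ltr0n// mul1r.
  by rewrite -[n%:R]/(n%:Z%:~R) ler_int -(big_expz_mono beta).
by have := @logb_ge b 1 1 b0 isT; rewrite divr1; apply; rewrite expr1z.
Qed.

Lemma value_group0 : value_group R beta 0.
Proof. by exists 1; rewrite ?logb1//=. Qed.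

Lemma value_group1 : value_group R beta 1.
Proof. by exists b; rewrite ?logb_big//= big_gt0. Qed.

Lemma value_groupB a c :
  value_group R beta a -> value_group R beta c -> value_group R beta (a - c).
Proof.
by move=> [h h0 <-] [k k0 <-]; exists (h / k); rewrite ?logb_div//= divr_gt0.
Qed.

Lemma value_group_half a :
  value_group R beta a -> value_group R beta (2^-1 * a).
Proof.
move=> [h h0 <-]; exists (Num.sqrt h); rewrite /= ?sqrtr_gt0//.
have := @logbX (Num.sqrt h) 2; rewrite sqr_sqrtr ?ltW// sqrtr_gt0.
by move=> /(_ h0) ->; rewrite mulrA mulVf ?mul1r.
Qed.

Lemma value_group_small e :
  0 < e -> exists2 a, value_group R beta a & 0 < a < e.
Proof.
move=> e0; suff [n ne] : exists n : nat, 2^-1 ^+ n < e.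
  exists (2^-1 ^+ n); last by rewrite ne andbT exprn_gt0.
  elim: {ne} n => [|n IH]; first by rewrite expr0; exact: value_group1.
  by rewrite exprS; exact: value_group_half.
exists (Num.truncn e^-1).
rewrite exprVn -[ltRHS]invrK ltf_pV2 ?posrE ?invr_gt0 ?exprn_gt0//.
apply: lt_le_trans (truncnS_gt _) _; rewrite -natrX ler_nat.
exact: ltn_expl.
Qed.

Hypothesis Fna : nonarchimedean F.

Lemma logb_nat n : log n.+1%:R = 0.
Proof.
apply/eqP; rewrite eq_le; apply/andP; split.
  apply/logb_le0P; first by rewrite ltr0n.
  by move=> m; rewrite -natrX big_gt_nat.
by rewrite -(logb1 R beta) ler_logb// ler1n.
Qed.

Lemma ler_logb_nat (n : nat) (h k : F) : 0 < h -> 0 < k -> h <= n%:R * k ->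
  log h <= log k.
Proof.
case: n => [|n] h0 k0 hk; first by move: hk; rewrite mul0r leNgt h0.
rewrite -[leRHS]add0r -(logb_nat n) -logbM ?ltr0n//; exact: ler_logb.
Qed.

End LogFacts.

(** * The disk and the tree *)

Section ComplexNorm.
Variable F : rcfType.
Implicit Types z w u al be : F[i].
Local Notation N := (@sqnormc F).
Local Notation "x %:C" := (real_complex F x).

Lemma sqnormc_ge0 z : 0 <= N z.
Proof. by rewrite addr_ge0 ?sqr_ge0. Qed.

Lemma sqnormc_eq0 z : N z = 0 -> z = 0.
Proof.
by move=> z0; apply/eqP; case: eqP => // /eqP/sqnormc_gt0; rewrite z0 ltxx.
Qed.

Lemma sqnormc_conj z : N (conjc z) = N z.
Proof. by case: z => x y; rewrite /sqnormc /= sqrrN. Qed.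

Lemma conjc_mul_sqnormc z : conjc z * z = (N z)%:C.
Proof.
by case: z => x y; apply/eqP; rewrite eq_complex /sqnormc /=; apply/andP; split;
  apply/eqP; ring.
Qed.

Lemma sqnormc_real (t : F) : N t%:C = t ^+ 2.
Proof. by rewrite /sqnormc /= expr0n addr0. Qed.

Lemma sqnormc1 : N 1 = 1.
Proof. by rewrite -[1](rmorph1 (real_complex F)) sqnormc_real expr1n. Qed.

Lemma sqnormcV z : N z^-1 = (N z)^-1.
Proof.
have [->|z0] := eqVneq z 0.
  by rewrite invr0 /sqnormc /= expr0n addr0 invr0.
have Nz0 : N z != 0 by rewrite gt_eqF// sqnormc_gt0.
by apply: (mulIf Nz0); rewrite -sqnormcM !mulVf// sqnormc1.
Qed.

Lemma sqnormcN z : N (- z) = N z.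
Proof. by case: z => x y; rewrite /sqnormc /= !sqrrN. Qed.

Lemma sqnormcD_le z w : N (z + w) <= 2 * (N z + N w).
Proof.
case: z w => [x y] [a c]; rewrite /sqnormc /= -subr_ge0.
suff -> : 2 * (x ^+ 2 + y ^+ 2 + (a ^+ 2 + c ^+ 2)) -
  ((x + a) ^+ 2 + (y + c) ^+ 2) = (x - a) ^+ 2 + (y - c) ^+ 2.
  by rewrite addr_ge0 ?sqr_ge0.
ring.
Qed.

Lemma sqnormc_pairing z w :
  N (1 - conjc z * w) = N (z - w) + (1 - N z) * (1 - N w).
Proof. by case: z w => [x y] [a c]; rewrite /sqnormc /=; ring. Qed.

Lemma disk_gt0 (z : disk F) : 0 < 1 - N z.
Proof. by rewrite subr_gt0 disk_lt1. Qed.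

Lemma pairing_gt0 (z w : disk F) : 0 < N (1 - conjc z * w).
Proof.
rewrite sqnormc_pairing ltr_wpDl ?sqnormc_ge0// mulr_gt0// disk_gt0//.
Qed.

(* The determinant of the Gram matrix of the hermitian form of signature (1,1);
   it yields Ptolemy's inequality, up to a factor. *)
Lemma pairing_plucker x y z w :
  (1 - conjc x * y) * (1 - conjc z * w) - (1 - conjc x * w) * (1 - conjc z * y)
  = conjc (x - z) * (w - y).
Proof. by rewrite rmorphB /=; ring. Qed.

Lemma pairing_ptolemy (x y z w : disk F) :
  N (1 - conjc x * y) * N (1 - conjc z * w) <=
  2 * (N (1 - conjc x * w) * N (1 - conjc y * z) +
       N (1 - conjc x * z) * N (1 - conjc y * w)).
Proof.
have pairC (u v : disk F) : N (1 - conjc u * v) = N (1 - conjc v * u).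
  by rewrite -sqnormc_conj rmorphB rmorphM rmorph1 /= conjcK mulrC.
have le (u v : disk F) : N (disk_val u - disk_val v) <= N (1 - conjc u * v).
  by rewrite sqnormc_pairing lerDl mulr_ge0// ltW// disk_gt0.
have := pairing_plucker x y z w.
move=> /(congr1 (+%R^~ ((1 - conjc x * w) * (1 - conjc z * y)))).
rewrite subrK => /(congr1 N); rewrite sqnormcM => ->.
apply: le_trans (sqnormcD_le _ _) _; rewrite !sqnormcM sqnormc_conj addrC.
rewrite (pairC z y) ler_pM2l// lerD2l ler_pM ?sqnormc_ge0 ?le//.
by rewrite pairC le.
Qed.

Section Mobius.

(* The action of the matrix of SU(1,1) with first row [al be]. *)
Definition su_num al be z := al * z + be.
Definition su_den al be z := conjc be * z + conjc al.
Definition su_act al be z := su_num al be z / su_den al be z.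

Definition su al be := N al - N be = 1.

Lemma su_conj al be : su al be -> conjc al * al - conjc be * be = 1.
Proof. by move=> h; rewrite !conjc_mul_sqnormc -rmorphB h rmorph1. Qed.

Lemma su_den_neq0 al be z : su al be -> N z <= 1 -> su_den al be z != 0.
Proof.
move=> h z1; apply/eqP => /addr0_eq /(congr1 N).
rewrite sqnormcN sqnormcM !sqnormc_conj => e.
suff : N al <= N be by rewrite leNgt -subr_gt0 h ltr01.
by rewrite -e ler_piMr ?sqnormc_ge0.
Qed.

Lemma su_pairing al be z w : su al be ->
  su_den al be z != 0 -> su_den al be w != 0 ->
  1 - conjc (su_act al be z) * su_act al be w =
  (1 - conjc z * w) / (conjc (su_den al be z) * su_den al be w).
Proof.
move=> /su_conj h z0 w0.
have cz0 : conjc (su_den al be z) != 0 by rewrite conjc_eq0.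
have -> : 1 - conjc z * w =
    (conjc al * al - conjc be * be) * (1 - conjc z * w) by rewrite h mul1r.
rewrite /su_act rmorphM /= fmorphV /=.
move: z0 w0 cz0.
rewrite /su_num /su_den !rmorphD !rmorphM /= !conjcK => z0 w0 cz0.
by field; apply/andP; split; [exact: w0|exact: cz0].
Qed.

Lemma su_sqnormc al be z : su al be -> su_den al be z != 0 ->
  1 - N (su_act al be z) = (1 - N z) / N (su_den al be z).
Proof.
move=> h z0; have := su_pairing h z0 z0; rewrite !conjc_mul_sqnormc.
rewrite -(rmorph1 (real_complex F)) -!rmorphB -fmorph_div.
exact: complexI.
Qed.

Lemma su_disk al be z : su al be -> N z < 1 -> N (su_act al be z) < 1.
Proof.
move=> h z1; have z0 := su_den_neq0 h (ltW z1).
by rewrite -subr_gt0 su_sqnormc// divr_gt0 ?subr_gt0 ?sqnormc_gt0.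
Qed.

Lemma su_circle al be z : su al be -> N z = 1 -> N (su_act al be z) = 1.
Proof.
move=> h z1; have z0 : su_den al be z != 0 by rewrite su_den_neq0 ?z1.
by apply/eqP; rewrite eq_sym -subr_eq0 su_sqnormc// z1 subrr mul0r.
Qed.

Lemma su_comp a1 b1 a2 b2 z : su a2 b2 -> N z <= 1 ->
  su_act a1 b1 (su_act a2 b2 z) =
  su_act (a1 * a2 + b1 * conjc b2) (a1 * b2 + b1 * conjc a2) z.
Proof.
move=> h z1; have := su_den_neq0 h z1; rewrite /su_act /su_num /su_den => z0.
set D := conjc b2 * z + conjc a2 in z0 *.
have -> : a1 * ((a2 * z + b2) / D) + b1 = (a1 * (a2 * z + b2) + b1 * D) / D.
  by field.
have -> : conjc b1 * ((a2 * z + b2) / D) + conjc a1 =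
    (conjc b1 * (a2 * z + b2) + conjc a1 * D) / D by field.
rewrite invf_div mulrA divfK//.
by rewrite !rmorphD !rmorphM /= !conjcK /D; congr (_ / _); ring.
Qed.

Lemma su_mul a1 b1 a2 b2 : su a1 b1 -> su a2 b2 ->
  su (a1 * a2 + b1 * conjc b2) (a1 * b2 + b1 * conjc a2).
Proof.
move=> h1 h2; suff : N (a1 * a2 + b1 * conjc b2) - N (a1 * b2 + b1 * conjc a2) =
  (N a1 - N b1) * (N a2 - N b2) by rewrite /su h1 h2 mulr1.
case: a1 b1 a2 b2 {h1 h2} => [? ?] [? ?] [? ?] [? ?]; rewrite /sqnormc /=; ring.
Qed.

Lemma su_inv al be : su al be -> su (conjc al) (- be).
Proof. by rewrite /su sqnormc_conj sqnormcN. Qed.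

Lemma su_actK al be z : su al be -> N z <= 1 ->
  su_act al be (su_act (conjc al) (- be) z) = z.
Proof.
move=> h z1; rewrite su_comp//; last exact: su_inv.
rewrite /su_act /su_num /su_den !rmorphD !rmorphM !rmorphN /= !conjcK.
have := su_conj h => e.
have -> : al * - be + be * al = 0 by ring.
have -> : al * conjc al + be * - conjc be = 1 by rewrite -e; ring.
have -> : conjc al * - conjc be + conjc be * conjc al = 0 by ring.
have -> : conjc al * al + conjc be * - be = 1 by rewrite -e; ring.
by rewrite mul0r add0r mul1r addr0 divr1.
Qed.

End Mobius.
End ComplexNorm.

Lemma det_mx22 (K : comNzRingType) (A : 'M[K]_2) :
  \det A = A 0 0 * A 1 1 - A 0 1 * A 1 0.
Proof.
rewrite (expand_det_row _ 0) !big_ord_recl big_ord0.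
rewrite /cofactor !det_mx11 !mxE /= addr0 /bump /=.
have -> : lift ord0 ord0 = 1 :> 'I_2 by apply/val_inj.
have -> : lift 1 0 = 0 :> 'I_2 by apply/val_inj.
ring.
Qed.

Section DiskAction.
Variable F : rcfType.
Local Notation N := (@sqnormc F).
Local Notation "x %:C" := (real_complex F x).
Local Notation iC := (Complex 0 1 : F[i]).

Definition su_al (A : 'M[F]_2) : F[i] :=
  Complex (2^-1 * (A 0 0 + A 1 1)) (2^-1 * (A 0 1 - A 1 0)).
Definition su_be (A : 'M[F]_2) : F[i] :=
  Complex (2^-1 * (A 0 0 - A 1 1)) (- (2^-1 * (A 0 1 + A 1 0))).

Lemma su_al_be (A : SL2 F) : su (su_al A) (su_be A).
Proof.
have := eqP (SL2_det A); rewrite det_mx22 /su /sqnormc /= => detA.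
by rewrite -[RHS]detA; field.
Qed.

Lemma cayley_mobius (A : SL2 F) (z : F[i]) : N z < 1 ->
  cayley (mobius A (cayley_inv z)) = su_act (su_al A) (su_be A) z.
Proof.
move=> z1; have suA := su_al_be A.
have u0 : 1 - z != 0.
  by apply: contraTneq z1 => /subr0_eq<-; rewrite sqnormc1 ltxx.
have den0 := su_den_neq0 suA (ltW z1).
set X := (A 0 0)%:C * (iC * (1 + z)) + (A 0 1)%:C * (1 - z).
set Y := (A 1 0)%:C * (iC * (1 + z)) + (A 1 1)%:C * (1 - z).
have mobE : mobius A (cayley_inv z) = X / Y.
  rewrite /mobius /cayley_inv /X /Y; set w := iC * _.
  have -> : (A 0 0)%:C * (w / (1 - z)) + (A 0 1)%:C =
    ((A 0 0)%:C * w + (A 0 1)%:C * (1 - z)) / (1 - z) by field.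
  have -> : (A 1 0)%:C * (w / (1 - z)) + (A 1 1)%:C =
    ((A 1 0)%:C * w + (A 1 1)%:C * (1 - z)) / (1 - z) by field.
  by rewrite invf_div mulrA divfK.
have XmY : X - iC * Y = 2%:C * iC * su_num (su_al A) (su_be A) z.
  rewrite /X /Y /su_num /su_al /su_be; case: z {u0 den0 mobE z1 X Y} => x y.
  by apply/eqP; rewrite eq_complex /=; apply/andP; split; apply/eqP; field.
have XpY : X + iC * Y = 2%:C * iC * su_den (su_al A) (su_be A) z.
  rewrite /X /Y /su_den /su_al /su_be; case: z {u0 den0 mobE z1 X Y XmY} => x y.
  by apply/eqP; rewrite eq_complex /=; apply/andP; split; apply/eqP; field.
have i20 : 2%:C * iC != 0.
  by rewrite eq_complex /= !mulr0 mul0r subr0 addr0 mulr1 eqxx /= pnatr_eq0.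
have Y0 : Y != 0.
  apply/eqP => Y0; move: XmY XpY.
  rewrite Y0 mulr0 addr0 subr0 => -> /(mulfI i20) e.
  have := su_sqnormc suA den0.
  rewrite /su_act e mulfV// sqnormc1 subrr => /esym/eqP.
  by rewrite mulf_eq0 invr_eq0 subr_eq0 !gt_eqF// sqnormc_gt0.
rewrite mobE /cayley.
have -> : X / Y - iC = (X - iC * Y) / Y by field.
have -> : X / Y + iC = (X + iC * Y) / Y by field.
by rewrite invf_div mulrA divfK// XmY XpY invfM mulrACA mulfV// mul1r.
Qed.

Lemma disk_act_su (g : PSL2 F) : exists al be, su al be /\
  forall z : disk F, disk_act g z = su_act al be z :> F[i].
Proof.
exists (su_al (repr g)), (su_be (repr g)); split; first exact: su_al_be.
by move=> z; exact/cayley_mobius/disk_lt1.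
Qed.

Lemma su_actN al be (z : F[i]) : su_act (- al) (- be) z = su_act al be z.
Proof.
rewrite /su_act /su_num /su_den !rmorphN /= !mulNr -!opprD invrN mulrNN//.
Qed.

Lemma su_realized (al be : F[i]) : su al be ->
  exists g : PSL2 F, forall z : disk F, disk_act g z = su_act al be z :> F[i].
Proof.
case: al be => [p q] [r s] h.
pose M : 'M[F]_2 := \matrix_(i < 2, j < 2)
  if i == 0 then if j == 0 then p + r else q - s
  else if j == 0 then - q - s else p - r.
have M1 : \det M == 1.
  by rewrite det_mx22 !mxE /= -h /sqnormc /=; apply/eqP; ring.
exists (toPSL2 (MkSL2 M1)) => z; rewrite /= cayley_mobius ?disk_lt1//.
have alE : su_al M = Complex p q.
  by rewrite /su_al !mxE /=; congr Complex; field.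
have beE : su_be M = Complex r s.
  by rewrite /su_be !mxE /=; congr Complex; field.
case/orP: (repr_toPSL2 (MkSL2 M1)) => /eqP -> /=; first by rewrite alE beE.
have -> : su_al (- M) = - Complex p q.
  rewrite -alE /su_al !mxE /=; apply/eqP; rewrite eq_complex /=.
  by apply/andP; split; apply/eqP; ring.
have -> : su_be (- M) = - Complex r s.
  rewrite -beE /su_be !mxE /=; apply/eqP; rewrite eq_complex /=.
  by apply/andP; split; apply/eqP; ring.
exact: su_actN.
Qed.

Lemma disk_act_surj (g : PSL2 F) (w : disk F) : exists z, disk_act g z = w.
Proof.
have [al [be [h gE]]] := disk_act_su g.
have [k kE] := su_realized (su_inv h).
exists (disk_act k w); apply/val_inj.
by rewrite [LHS]gE kE su_actK// ltW// disk_lt1.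
Qed.

Lemma disk_act_origin (z : disk F) : exists g, disk_act g (origin F) = z.
Proof.
pose r := (Num.sqrt (1 - N z))^-1.
have z1 := disk_gt0 z.
have r2 : r ^+ 2 = (1 - N z)^-1 by rewrite exprVn sqr_sqrtr// ltW.
have h : su r%:C (r%:C * z).
  rewrite /su sqnormcM sqnormc_real r2 -{1}[_^-1]mulr1 -mulrBr mulVf//.
  by rewrite gt_eqF.
have [g gE] := su_realized h; exists g; apply/val_inj.
have r0 : r%:C != 0.
  by rewrite (fmorph_eq0 (real_complex F)) invr_eq0 gt_eqF// sqrtr_gt0.
rewrite [LHS]gE; change (su_act r%:C (r%:C * z) 0 = z).
rewrite /su_act /su_num /su_den !mulr0 !add0r.
by rewrite conjc_real mulrC mulKf.
Qed.

End DiskAction.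

Lemma four_point_tri (R : realType) (X : Type) (d : X -> X -> R) :
  (forall x, d x x = 0) -> (forall x y, d x y = d y x) -> four_point d ->
  forall x y z, d x z <= d x y + d y z.
Proof.
move=> d0 dC d4 x y z; have := d4 x z y y.
by rewrite d0 addr0 (dC z y) maxxx.
Qed.

Section DiskMetric.
Variables (R : realType) (F : rcfType) (beta : bigElement F).
Local Notation N := (@sqnormc F).
Local Notation "x %:C" := (real_complex F x).
Local Notation log := (logb R beta).
Local Notation dd := (@disk_dist R F beta).

Definition disk_ratio (z w : disk F) : F :=
  N (1 - conjc z * w) / ((1 - N z) * (1 - N w)).

Lemma disk_ratio_gt0 z w : 0 < disk_ratio z w.
Proof. by rewrite divr_gt0 ?pairing_gt0// mulr_gt0// disk_gt0. Qed.

Lemma disk_dist_act g z w : dd (disk_act g z) (disk_act g w) = dd z w.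
Proof.
rewrite /disk_dist; congr logb; have [al [be [h gE]]] := disk_act_su g.
have z0 := su_den_neq0 h (ltW (disk_lt1 z)).
have w0 := su_den_neq0 h (ltW (disk_lt1 w)).
rewrite !gE su_pairing// !su_sqnormc// sqnormcM sqnormcV sqnormcM sqnormc_conj.
have Nz0 : N (su_den al be z) != 0 by rewrite gt_eqF// sqnormc_gt0.
have Nw0 : N (su_den al be w) != 0 by rewrite gt_eqF// sqnormc_gt0.
have z1 : 1 - N z != 0 by rewrite gt_eqF// disk_gt0.
have w1 : 1 - N w != 0 by rewrite gt_eqF// disk_gt0.
by field; rewrite Nz0 Nw0 z1 w1.
Qed.

Lemma disk_dist_refl z : dd z z = 0.
Proof.
rewrite /disk_dist sqnormc_pairing subrr.
rewrite (_ : N 0 = 0) ?add0r; last by rewrite /sqnormc /= expr0n addr0.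
by rewrite mulfV ?logb1// mulf_neq0// gt_eqF// disk_gt0.
Qed.

Lemma disk_dist_sym z w : dd z w = dd w z.
Proof.
rewrite /disk_dist mulrC [in RHS]mulrC [(1 - N w) * _]mulrC.
congr (log (_ * _)).
by rewrite -sqnormc_conj rmorphB rmorphM rmorph1 /= conjcK mulrC.
Qed.

Hypothesis Fna : nonarchimedean F.

Lemma disk_dist_four_point : four_point dd.
Proof.
move=> x y z w; rewrite le_max.
have ratioE a c : dd a c = log (disk_ratio a c) by [].
rewrite !ratioE -!logbM ?disk_ratio_gt0//.
have pt := pairing_ptolemy x y z w.
have [x1 y1] := (disk_gt0 x, disk_gt0 y).
have [z1 w1] := (disk_gt0 z, disk_gt0 w).
set P := (1 - N x) * (1 - N y) * (1 - N z) * (1 - N w).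
have P0 : 0 < P by rewrite !mulr_gt0.
have -> : disk_ratio x y * disk_ratio z w =
    N (1 - conjc x * y) * N (1 - conjc z * w) / P.
  by rewrite /disk_ratio /P; field; rewrite !gt_eqF.
have -> : disk_ratio x z * disk_ratio y w =
    N (1 - conjc x * z) * N (1 - conjc y * w) / P.
  by rewrite /disk_ratio /P; field; rewrite !gt_eqF.
have -> : disk_ratio x w * disk_ratio y z =
    N (1 - conjc x * w) * N (1 - conjc y * z) / P.
  by rewrite /disk_ratio /P; field; rewrite !gt_eqF.
move: pt; set A := N (1 - conjc x * y) * N (1 - conjc z * w).
set B := N (1 - conjc x * z) * N (1 - conjc y * w).
set C := N (1 - conjc x * w) * N (1 - conjc y * z) => pt.
have A0 : 0 < A by rewrite mulr_gt0 ?pairing_gt0.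
have B0 : 0 < B by rewrite mulr_gt0 ?pairing_gt0.
have C0 : 0 < C by rewrite mulr_gt0 ?pairing_gt0.
have [BC|CB] := leP B C; apply/orP; [right|left].
  apply: (@ler_logb_nat _ _ _ Fna 4); rewrite ?divr_gt0//.
  rewrite mulrA ler_pM2r ?invr_gt0//; lra.
apply: (@ler_logb_nat _ _ _ Fna 4); rewrite ?divr_gt0//.
rewrite mulrA ler_pM2r ?invr_gt0//; lra.
Qed.

Lemma disk_dist_tri x y z : dd x z <= dd x y + dd y z.
Proof.
apply: four_point_tri; first exact: disk_dist_refl.
  exact: disk_dist_sym.
exact: disk_dist_four_point.
Qed.

(* The distance from the origin of the point at parameter [t] on a ray. *)
Definition ray_dist (t : F) : R := log (1 - t ^+ 2)^-1.

Lemma one_sub_sqr_gt0 (t : F) : 0 <= t < 1 -> 0 < 1 - t ^+ 2.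
Proof. by move=> /andP[t0 t1]; rewrite subr_gt0 expr_lt1. Qed.

Lemma ray_dist_onto a : value_group R beta a -> 0 <= a ->
  exists2 t, 0 <= t < 1 & ray_dist t = a.
Proof.
move=> [h h0 <-] a0.
have [t t01 e] : exists2 k, 1 <= k & log k = log h.
  have [h1|h1] := leP 1 h; first by exists h.
  exists 1; rewrite // logb1; apply/eqP; rewrite eq_le a0 -(logb1 R beta).
  by rewrite ler_logb// ltW.
have t0 : 0 < t by apply: lt_le_trans t01.
exists (Num.sqrt (1 - t^-1)).
  by rewrite sqrtr_ge0 -[ltRHS]sqrtr1 ltr_sqrt// gtrBl invr_gt0.
rewrite /ray_dist sqr_sqrtr ?subr_ge0 ?invf_le1//.
by rewrite opprB addrCA subrr addr0 invrK.
Qed.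

Lemma ray_pointE (u : F[i]) (t : F) : circle F u -> 0 <= t < 1 ->
  disk_val (ray_point u t) = t%:C * u.
Proof.
move=> u1 /andP[t0 t1]; rewrite /ray_point insubdK// -topredE /=.
by rewrite sqnormcM sqnormc_real [N u]u1 mulr1 expr_lt1.
Qed.

Lemma ray_dist_pairing (u : F[i]) (t s : F) : circle F u ->
  conjc (t%:C * u) * (s%:C * u) = (t * s)%:C.
Proof.
have conjcM (z w : F[i]) : conjc (z * w) = conjc z * conjc w by exact: rmorphM.
move=> u1; rewrite conjcM conjc_real mulrACA conjc_mul_sqnormc [N u]u1.
by rewrite mulr1 rmorphM.
Qed.

Lemma disk_dist_ray u t s : circle F u -> 0 <= t -> t <= s -> s < 1 ->
  dd (ray_point u t) (ray_point u s) = ray_dist s - ray_dist t.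
Proof.
move=> u1 t0 ts s1; have [s0 t1] : 0 <= s /\ t < 1 by split; lra.
rewrite /disk_dist !ray_pointE ?t0 ?s0// ray_dist_pairing//.
rewrite -(rmorph1 (real_complex F)) -rmorphB.
rewrite !sqnormcM !sqnormc_real [N u]u1 !mulr1.
have t2 : 0 < 1 - t ^+ 2 by rewrite one_sub_sqr_gt0 ?t0.
have s2 : 0 < 1 - s ^+ 2 by rewrite one_sub_sqr_gt0 ?s0.
have ts0 : 0 < 1 - t * s by rewrite subr_gt0 mulr_ilt1.
rewrite /ray_dist !logbV// logb_div ?exprn_gt0// ?mulr_gt0// logbX// logbM//.
have -> : log (1 - t * s) = log (1 - t ^+ 2).
  apply/eqP; rewrite eq_le; apply/andP; split.
    rewrite ler_logb// lerD2l lerN2 expr2 ler_wpM2l//.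
  apply: (@ler_logb_nat _ _ _ Fna 2) => //.
  have : t * s <= t by rewrite ler_piMr// ltW.
  by have := sqr_ge0 (1 - t); rewrite !expr2; lra.
by rewrite mulr2n; ring.
Qed.

Lemma disk_dist_origin_ray u t : circle F u -> 0 <= t < 1 ->
  dd (origin F) (ray_point u t) = ray_dist t.
Proof.
move=> u1 /andP[t0 t1].
have -> : origin F = ray_point u 0.
  by apply: val_inj; rewrite [RHS]ray_pointE ?lexx ?ltr01// rmorph0 mul0r.
rewrite disk_dist_ray// /ray_dist expr0n subr0 invr1 logb1 subr0//.
Qed.

Lemma disk_polar (z : disk F) : exists u t,
  [/\ circle F u, 0 <= t < 1 & z = ray_point u t].
Proof.
have [z0|z0] := eqVneq (disk_val z) 0.
  have c1 : circle F 1 by rewrite /circle /= expr1n expr0n addr0.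
  exists 1, 0; split; rewrite ?lexx ?ltr01//.
  by apply: val_inj; rewrite [RHS]ray_pointE ?lexx ?ltr01// rmorph0 mul0r.
have Nz0 := sqnormc_gt0 z0; pose t := Num.sqrt (N z).
have t0 : 0 < t by rewrite sqrtr_gt0.
have t01 : 0 <= t < 1 by rewrite ltW//= -[ltRHS]sqrtr1 ltr_sqrt// disk_lt1.
have u1 : circle F (t^-1%:C * z).
  change (N (t^-1%:C * z) = 1); rewrite sqnormcM sqnormc_real exprVn.
  by rewrite sqr_sqrtr ?mulVf ?gt_eqF// ltW.
exists (t^-1%:C * z), t; split=> //; apply: val_inj; rewrite [RHS]ray_pointE//.
by rewrite mulrA -rmorphM mulfV ?gt_eqF// rmorph1 mul1r.
Qed.

Local Notation Lambda := (value_group R beta).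
Local Notation T := (tree R beta).
Local Notation dT := (tree_dist R beta).
Local Notation piT := (@tree_pi R F beta).

Lemma tree_distE z w : dT (piT z) (piT w) = dd z w.
Proof.
apply: sep_distE; first exact: disk_dist_refl.
  exact: disk_dist_sym.
exact: disk_dist_tri.
Qed.

Lemma tree_pi_eq z w : piT z = piT w <-> dd z w = 0.
Proof.
apply: sep_pi_eq; first exact: disk_dist_refl.
  exact: disk_dist_sym.
exact: disk_dist_tri.
Qed.

Lemma tree_pi_surj (p : T) : exists z, p = piT z.
Proof. exact: sep_pi_surj. Qed.

Lemma tree_is_metric : is_metric dT.
Proof.
apply: sep_is_metric; first exact: disk_dist_refl.
  exact: disk_dist_sym.
exact: disk_dist_tri.
Qed.

Lemma tree_four_point : four_point dT.
Proof.
apply: sep_four_point; last exact: disk_dist_four_point.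
- exact: disk_dist_refl.
- exact: disk_dist_sym.
- exact: disk_dist_tri.
Qed.

Lemma tree_dist_value p q : Lambda (dT p q).
Proof.
have [z ->] := tree_pi_surj p; have [w ->] := tree_pi_surj q.
by rewrite tree_distE; exists (disk_ratio z w) => //; exact: disk_ratio_gt0.
Qed.

Lemma base_point_surj (p : T) : exists g, base_point R beta g = p.
Proof.
have [z ->] := tree_pi_surj p; have [g gz] := disk_act_origin z.
by exists g; rewrite /base_point gz.
Qed.

Definition tree_ray g u t : T := piT (disk_act g (ray_point u t)).

Lemma tree_dist_ray g u t s : circle F u -> 0 <= t -> t <= s -> s < 1 ->
  dT (tree_ray g u t) (tree_ray g u s) = ray_dist s - ray_dist t.
Proof. by move=> *; rewrite tree_distE disk_dist_act disk_dist_ray. Qed.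

Lemma tree_dist_base_ray g u t : circle F u -> 0 <= t < 1 ->
  dT (base_point R beta g) (tree_ray g u t) = ray_dist t.
Proof. by move=> *; rewrite tree_distE disk_dist_act disk_dist_origin_ray. Qed.

Lemma tree_polar g q : exists u t,
  [/\ circle F u, 0 <= t < 1 & q = tree_ray g u t].
Proof.
have [w ->] := tree_pi_surj q; have [z <-] := disk_act_surj g w.
by have [u [t [u1 t1 ->]]] := disk_polar z; exists u, t.
Qed.

Lemma ray_dist_lt (t s : F) : 0 <= t < 1 -> 0 <= s < 1 ->
  ray_dist t < ray_dist s -> t < s.
Proof.
move=> ht hs; rewrite !ltNge; apply: contra => st.
rewrite ler_logb ?invr_gt0 ?one_sub_sqr_gt0// lef_pV2 ?posrE ?one_sub_sqr_gt0//.
by rewrite lerD2l lerN2 lerXn2r ?nnegrE//; lra.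
Qed.

Lemma tree_convex x y a : Lambda a -> 0 <= a <= dT x y ->
  exists z, dT x z = a /\ between dT x z y.
Proof.
move=> La /andP[a0]; have [g <-] := base_point_surj x.
have [u [s [u1 s1 ->]]] := tree_polar g y; rewrite tree_dist_base_ray// => al.
have [t t1 ta] := ray_dist_onto La a0.
have [as_|sa] := eqVneq a (ray_dist s).
  exists (tree_ray g u s); rewrite tree_dist_base_ray//; split=> //.
  by rewrite /between (is_metric_refl tree_is_metric) addr0.
have /ltW ts : t < s by apply: ray_dist_lt; rewrite ?ta// lt_neqAle sa.
have [/andP[t0 _] /andP[_ slt1]] := (t1, s1).
have xt := tree_dist_base_ray g u1 t1; have xs := tree_dist_base_ray g u1 s1.
have tsE := tree_dist_ray g u1 t0 ts slt1.
exists (tree_ray g u t); split; first by rewrite xt.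
by rewrite /between xt xs tsE addrC subrK.
Qed.

Lemma tree_incl_const (p : T) : exists2 v : segSequence Lambda dT,
  forall n, v n = p & tree_incl p = sep_pi (@seg_seq_dist R Lambda T dT) v.
Proof.
by exists (@SegSequence R Lambda T dT (fun=> p) (const_seq_in p)
  (const_seq_cauchy p)).
Qed.

End DiskMetric.

(** * The circle over the residue field *)

Section CircleOrder.
Variable K : realFieldType.
Implicit Types z : K[i].

Definition circle_det z1 z2 z3 : K :=
  (complex.Re z2 - complex.Re z1) * (complex.Im z3 - complex.Im z2) -
  (complex.Re z3 - complex.Re z2) * (complex.Im z2 - complex.Im z1).

Lemma circle_orderE z1 z2 z3 :
  circle_order z1 z2 z3 = sgz (circle_det z1 z2 z3).
Proof.
rewrite /circle_order /circle_det; congr sgz.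
case: z1 z2 z3 => [x1 y1] [x2 y2] [x3 y3].
set M := row_mx _ _.
have M0 i : M i 0 = col_of_complex (Complex x2 y2 - Complex x1 y1) i 0.
  by rewrite mxE; case: splitP => // k _; rewrite (ord1 k).
have M1 i : M i 1 = col_of_complex (Complex x3 y3 - Complex x2 y2) i 0.
  by rewrite mxE; case: splitP => // k; rewrite (ord1 k).
by rewrite det_mx22 !M0 !M1 !mxE /=; ring.
Qed.

Lemma circle_det_rot z1 z2 z3 : circle_det z1 z2 z3 = circle_det z2 z3 z1.
Proof. by rewrite /circle_det; ring. Qed.

Lemma circle_det_swap z1 z2 z3 : circle_det z1 z2 z3 = - circle_det z1 z3 z2.
Proof. by rewrite /circle_det; ring. Qed.

Lemma sqr_sum_eq0 (u v : K) : u ^+ 2 + v ^+ 2 = 0 -> u = 0 /\ v = 0.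
Proof.
move=> /eqP; rewrite paddr_eq0 ?sqr_ge0// !sqrf_eq0 => /andP[/eqP-> /eqP->].
by [].
Qed.

Lemma circle_det_eq0 z1 z2 z3 : circle K z1 -> circle K z2 -> circle K z3 ->
  circle_det z1 z2 z3 = 0 <-> [\/ z1 = z2, z2 = z3 | z1 = z3].
Proof.
move=> c1 c2 c3; split=> [|[] ->]; rewrite /circle_det; last first.
- ring.
- ring.
- ring.
case: z1 z2 z3 c1 c2 c3 => [x1 y1] [x2 y2] [x3 y3]; rewrite /circle /=.
move=> c1 c2 c3 D0.
set a := x2 - x1; set b := y2 - y1; set c := x3 - x1; set e := y3 - y1.
have {}D0 : a * e - c * b = 0 by rewrite /a /b /c /e; lra.
have AE : a ^+ 2 + b ^+ 2 = - 2 * (x1 * a + y1 * b) by rewrite /a /b; lra.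
have CE : c ^+ 2 + e ^+ 2 = - 2 * (x1 * c + y1 * e) by rewrite /c /e; lra.
have e1 : a * (c ^+ 2 + e ^+ 2) = c * (a ^+ 2 + b ^+ 2).
  by rewrite AE CE; have := congr1 ( *%R y1) D0; lra.
have e2 : b * (c ^+ 2 + e ^+ 2) = e * (a ^+ 2 + b ^+ 2).
  by rewrite AE CE; have := congr1 ( *%R x1) D0; lra.
have [/sqr_sum_eq0[/subr0_eq -> /subr0_eq ->]|A0] := eqVneq (a ^+ 2 + b ^+ 2) 0.
  exact: Or31.
have [/sqr_sum_eq0[/subr0_eq -> /subr0_eq ->]|C0] := eqVneq (c ^+ 2 + e ^+ 2) 0.
  exact: Or33.
have AC : c ^+ 2 + e ^+ 2 = a ^+ 2 + b ^+ 2.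
  apply: (mulfI A0); apply: (mulfI C0).
  transitivity ((a * (c ^+ 2 + e ^+ 2)) ^+ 2 + (b * (c ^+ 2 + e ^+ 2)) ^+ 2).
    ring.
  by rewrite e1 e2; ring.
rewrite AC in e1 e2; apply: Or32.
by move: (mulIf A0 e1) (mulIf A0 e2) => /addIr -> /addIr ->.
Qed.

Lemma circle_det_trans z1 z2 z3 z4 : circle K z1 -> circle K z2 ->
  circle K z3 -> circle K z4 ->
  0 < circle_det z1 z2 z3 -> 0 < circle_det z1 z3 z4 ->
  0 < circle_det z1 z2 z4.
Proof.
case: z1 z2 z3 z4 => [x1 y1] [x2 y2] [x3 y3] [x4 y4].
rewrite /circle /circle_det /= => c1 c2 c3 c4 D123 D134.
pose n (x y : K) := (x - x1) ^+ 2 + (y - y1) ^+ 2.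
have n_ge0 x y : 0 <= n x y by rewrite addr_ge0 ?sqr_ge0.
have n2 : 0 < n x2 y2.
  rewrite lt_neqAle n_ge0 andbT eq_sym; apply/eqP => /sqr_sum_eq0[a0 b0].
  by move: D123; rewrite a0 b0 mul0r mulr0 subrr ltxx.
have n3 : 0 < n x3 y3.
  rewrite lt_neqAle n_ge0 andbT eq_sym; apply/eqP => /sqr_sum_eq0[a0 b0].
  by move: D134; rewrite a0 b0 mul0r mulr0 subrr ltxx.
have nE x y : x ^+ 2 + y ^+ 2 = 1 ->
    n x y = - 2 * (x1 * (x - x1) + y1 * (y - y1)) by rewrite /n; lra.
rewrite -(pmulr_lgt0 _ n3).
suff -> : ((x2 - x1) * (y4 - y2) - (x4 - x2) * (y2 - y1)) * n x3 y3 =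
    ((x2 - x1) * (y3 - y2) - (x3 - x2) * (y2 - y1)) * n x4 y4 +
    ((x3 - x1) * (y4 - y3) - (x4 - x3) * (y3 - y1)) * n x2 y2.
  by rewrite ltr_wpDl ?mulr_ge0 ?mulr_gt0// ltW.
by rewrite !nE//; ring.
Qed.

Lemma cyclic_order_circle : cyclic_order (circle K) (@circle_order K).
Proof.
split=> [x y z cx cy cz|x y z t cx cy cz ct]; rewrite !circle_orderE.
  split.
  - by case: sgzP.
  - rewrite card_set3_le2 -circle_det_eq0//.
    split=> [/eqP|->]; last exact: sgz0.
    by rewrite sgz_eq0 => /eqP.
  - by rewrite circle_det_rot.
  - by rewrite circle_det_swap sgzN.
move=> /eqP + /eqP; rewrite !sgz_cp0 => xyz xzt; apply/eqP.
by rewrite sgz_cp0; exact: circle_det_trans xyz xzt.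
Qed.

End CircleOrder.

Section ResidueFacts.
Variables (R : realType) (F : rcfType).
Variables (Fna : nonarchimedean F) (beta : bigElement F).
Local Notation log := (logb R beta).
Local Notation O := (val_ring R beta Fna).
Local Notation K := (resField R Fna beta).
Local Notation res := (residue R Fna beta).

Lemma val_ring_le_nat (x : F) (n : nat) : `|x| <= n%:R -> x \in O.
Proof.
move=> xn; apply/val_ringP => m.
apply: le_lt_trans (big_gt_nat Fna beta (n ^ m)).
by rewrite natrX lerXn2r ?nnegrE.
Qed.

Lemma val_ring_log (x : F) : 0 < x -> log x <= 0 -> x \in O.
Proof. by move=> x0 xl; rewrite inE gtr0_norm// xl orbT. Qed.

Lemma residue_val (x : F) (xO : x \in O) : res x = residue_class (MkValRing xO).
Proof.
by congr residue_class; apply: val_inj; rewrite /= insubdK.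
Qed.

Lemma residue_eq0 (x : F) : x \in O -> res x = 0 <-> x = 0 \/ log `|x| < 0.
Proof.
move=> xO; rewrite residue_val; split=> [/eqP|h].
  by rewrite residue_class_eq0 inE /= => /orP[/eqP|]; [left|right].
apply/eqP; rewrite residue_class_eq0 inE /=; apply/orP.
by case: h => [->|]; [left|right].
Qed.

Lemma residueB (x y : F) : x \in O -> y \in O -> res (x - y) = res x - res y.
Proof.
move=> xO yO.
rewrite (residue_val xO) (residue_val yO) (residue_val (rpredB xO yO)).
by rewrite -rmorphB; congr residue_class; exact: val_inj.
Qed.

Lemma residueM (x y : F) : x \in O -> y \in O -> res (x * y) = res x * res y.
Proof.
move=> xO yO.
rewrite (residue_val xO) (residue_val yO) (residue_val (rpredM xO yO)).
by rewrite -rmorphM; congr residue_class; exact: val_inj.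
Qed.

Lemma residue1 : res 1 = 1.
Proof.
rewrite (residue_val (rpred1 O)) -(rmorph1 (@residue_class R F Fna beta)).
by congr residue_class; exact: val_inj.
Qed.

Lemma residueD (x y : F) : x \in O -> y \in O -> res (x + y) = res x + res y.
Proof.
move=> xO yO.
rewrite (residue_val xO) (residue_val yO) (residue_val (rpredD xO yO)).
by rewrite -rmorphD; congr residue_class; exact: val_inj.
Qed.

Lemma residue_onto (q : K) : exists2 x, x \in O & res x = q.
Proof.
exists (val (repr q)); first exact: valRingP.
rewrite -[RHS]residue_classK (residue_val (valRingP _)).
by congr residue_class; exact: val_inj.
Qed.

Lemma residue_gt0 (c : F) : 0 < c -> c \in O -> c^-1 \in O -> 0 < res c.
Proof.
move=> c0 cO ciO; rewrite lt_neqAle; apply/andP; split.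
  apply/eqP => c00; have := residueM cO ciO.
  by rewrite mulfV ?gt_eqF// residue1 -c00 mul0r => /eqP; rewrite oner_eq0.
change (resField_le 0 (res c)); apply/resField_ge0P.
by exists (MkValRing cO); [exact: ltW|exact: residue_val].
Qed.

Lemma sgz_residueM (x c : F) : x \in O -> 0 < c -> c \in O -> c^-1 \in O ->
  sgz (res (x * c)) = sgz (res x).
Proof.
move=> xO c0 cO ciO.
by rewrite (residueM xO cO) sgzM (gtr0_sgz (residue_gt0 c0 cO ciO)) mulr1.
Qed.

Lemma circle_val_ring (u : F[i]) : circle F u ->
  complex.Re u \in O /\ complex.Im u \in O.
Proof.
case: u => x y; rewrite /circle /= => u1.
split; apply: (@val_ring_le_nat _ 1);
  rewrite -(ler_pXn2r (_ : 0 < 2)%N) ?nnegrE// expr1n.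
  by rewrite real_normK ?num_real// -u1 lerDl sqr_ge0.
by rewrite real_normK ?num_real// -u1 lerDr sqr_ge0.
Qed.

Lemma reduce_circle (u : F[i]) : circle F u -> circle K (reduce R Fna beta u).
Proof.
move=> u1; have [xO yO] := circle_val_ring u1; rewrite /circle /= !expr2.
by rewrite -!residueM// -residueD ?rpredM// -!expr2 [_ + _]u1 residue1.
Qed.

Lemma reduce_onto (v : K[i]) : circle K v ->
  exists2 u, circle F u & reduce R Fna beta u = v.
Proof.
case: v => p q; rewrite /circle /= => v1.
have [x xO xp] := residue_onto p; have [y yO yq] := residue_onto q.
pose n := x ^+ 2 + y ^+ 2.
have nO : n \in O by rewrite rpredD// expr2 rpredM.
have n1 : res n = 1.
  by rewrite /n residueD ?expr2 ?rpredM// !residueM// xp yq -!expr2.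
have n0 : 0 < n.
  rewrite lt_neqAle addr_ge0 ?sqr_ge0// andbT; apply/eqP => n0.
  have res0 : res 0 = 0 by apply/(residue_eq0 (rpred0 O)); left.
  by move: n1; rewrite -n0 res0 => /esym/eqP; rewrite oner_eq0.
have logn : log n = 0.
  apply/eqP; rewrite eq_le; apply/andP; split.
    by move: nO; rewrite inE gt_eqF//= gtr0_norm.
  rewrite leNgt; apply/negP => nl; move: n1; rewrite (iffRL (residue_eq0 nO)).
    by move/esym/eqP; rewrite oner_eq0.
  by right; rewrite gtr0_norm.
pose r := Num.sqrt n; have r0 : 0 < r by rewrite sqrtr_gt0.
have logr : log r = 0.
  have := @logbX R F beta r 2 r0; rewrite sqr_sqrtr ?ltW// logn; lra.
have rO : r \in O by rewrite val_ring_log ?logr.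
have riO : r^-1 \in O by rewrite val_ring_log ?invr_gt0// logbV// logr oppr0.
have rr : res r = 1.
  have := residue_gt0 r0 rO riO; have : res r ^+ 2 = 1.
    by rewrite expr2 -residueM// -expr2 sqr_sqrtr// ltW.
  move=> /eqP; rewrite -subr_eq0 subr_sqr_1 mulf_eq0 => /orP[/eqP|/eqP].
    by move/subr0_eq.
  by move=> h h0; lra.
have rir : res r^-1 = 1.
  by have := residueM rO riO; rewrite mulfV ?gt_eqF// residue1 rr mul1r.
exists (Complex (x / r) (y / r)).
  rewrite /circle /= !expr_div_n -mulrDl -/n sqr_sqrtr ?ltW// mulfV// gt_eqF//.
by rewrite /reduce /= !residueM// xp yq rir !mulr1.
Qed.

Lemma reduce_eq (u v : F[i]) : circle F u -> circle F v ->
  reduce R Fna beta u = reduce R Fna beta v <->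
  u = v \/ log (sqnormc (u - v)) < 0.
Proof.
move=> cu cv.
have [xO yO] := circle_val_ring cu; have [x'O y'O] := circle_val_ring cv.
have nO : sqnormc (u - v) \in O.
  rewrite /sqnormc !expr2.
  case: u v {cu cv} xO yO x'O y'O => [x y] [x' y'] /= *.
  by rewrite rpredD// rpredM// rpredB.
have -> : reduce R Fna beta u = reduce R Fna beta v <->
    res (sqnormc (u - v)) = 0.
  rewrite /reduce /sqnormc.
  case: u v {cu cv nO} xO yO x'O y'O => [x y] [x' y'] /= xO yO x'O y'O.
  rewrite !expr2 residueD ?rpredM ?rpredB// !residueM ?rpredB// !residueB//.
  rewrite -!expr2; split=> [[-> ->]|].
    by rewrite !subrr !expr0n addr0.
  by move=> /sqr_sum_eq0[/subr0_eq -> /subr0_eq ->].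
rewrite residue_eq0// ger0_norm ?sqnormc_ge0//; split=> -[h|]; try by right.
  by left; apply/subr0_eq/sqnormc_eq0.
by left; rewrite h subrr /sqnormc /= expr0n addr0.
Qed.

Lemma circle_order_reduce (u1 u2 u3 : F[i]) :
  circle F u1 -> circle F u2 -> circle F u3 ->
  circle_order (reduce R Fna beta u1) (reduce R Fna beta u2)
    (reduce R Fna beta u3) = sgz (res (circle_det u1 u2 u3)).
Proof.
move=> c1 c2 c3; rewrite circle_orderE; congr sgz.
have [? ?] := circle_val_ring c1; have [? ?] := circle_val_ring c2.
have [? ?] := circle_val_ring c3.
by rewrite /circle_det residueB ?rpredM ?rpredB// !residueM ?rpredB// !residueB.
Qed.

End ResidueFacts.

Section SuCircle.
Variable F : rcfType.
Local Notation N := (@sqnormc F).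
Local Notation "x %:C" := (real_complex F x).
Implicit Types z u al be : F[i].

Lemma circle_conj z : circle F z -> conjc z * z = 1.
Proof. by move=> z1; rewrite conjc_mul_sqnormc [N z]z1. Qed.

(* The conjugate of a point of the circle is its inverse. *)
Lemma circle_det_complex z1 z2 z3 :
  circle F z1 -> circle F z2 -> circle F z3 ->
  2 * Complex 0 1 * (circle_det z1 z2 z3)%:C * (z1 * z2 * z3) =
  (z1 - z2) * (z2 - z3) * (z1 - z3).
Proof.
move=> /circle_conj c1 /circle_conj c2 /circle_conj c3.
have -> : 2 * Complex 0 1 * (circle_det z1 z2 z3)%:C =
    conjc (z2 - z1) * (z3 - z2) - conjc (z3 - z2) * (z2 - z1).
  case: z1 z2 z3 {c1 c2 c3} => [x1 y1] [x2 y2] [x3 y3]; rewrite /circle_det.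
  by apply/eqP; rewrite eq_complex /=; apply/andP; split; apply/eqP; ring.
rewrite !rmorphB /=.
have -> : ((conjc z2 - conjc z1) * (z3 - z2) -
    (conjc z3 - conjc z2) * (z2 - z1)) * (z1 * z2 * z3) =
  (conjc z2 * z2) * z1 * z3 * (z3 - z2) -
  (conjc z1 * z1) * z2 * z3 * (z3 - z2) -
  (conjc z3 * z3) * z1 * z2 * (z2 - z1) +
  (conjc z2 * z2) * z1 * z3 * (z2 - z1) by ring.
rewrite c1 c2 c3; ring.
Qed.

Lemma circle_det_su al be z1 z2 z3 : su al be ->
  circle F z1 -> circle F z2 -> circle F z3 ->
  circle_det (su_act al be z1) (su_act al be z2) (su_act al be z3) =
  circle_det z1 z2 z3 / (N (su_den al be z1) * N (su_den al be z2) *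
    N (su_den al be z3)).
Proof.
move=> h c1 c2 c3; have suh := su_conj h.
have circle_neq0 z : circle F z -> z != 0.
  move=> /circle_conj zz; apply/eqP => z0; move: zz; rewrite z0 mulr0.
  by move/esym/eqP; rewrite oner_eq0.
have den0 z : circle F z -> su_den al be z != 0.
  by move=> z1'; rewrite su_den_neq0// [N z]z1'.
have numE z : circle F z ->
    su_act al be z = z * conjc (su_den al be z) / su_den al be z.
  move=> /circle_conj zz; rewrite /su_act; congr (_ / _).
  rewrite /su_num /su_den rmorphD rmorphM /= !conjcK.
  by rewrite mulrDr mulrCA (mulrC z (conjc z)) zz mulr1 addrC mulrC.
have subE z w : circle F z -> circle F w -> su_act al be z - su_act al be w =
    (z - w) / (su_den al be z * su_den al be w).
  move=> /den0 + /den0; rewrite /su_act /su_num /su_den => z0 w0.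
  have -> : z - w = (conjc al * al - conjc be * be) * (z - w).
    by rewrite suh mul1r.
  by field; rewrite z0 w0.
have [[n1 n2] n3] := (den0 _ c1, den0 _ c2, den0 _ c3).
have DE := circle_det_complex c1 c2 c3.
have := circle_det_complex (su_circle h c1) (su_circle h c2) (su_circle h c3).
move: DE; set D := circle_det z1 z2 z3; set D' := circle_det (su_act _ _ _) _ _.
rewrite !subE// !numE// => DE D'E.
apply: complexI; rewrite fmorph_div !rmorphM /= -!conjc_mul_sqnormc.
move: n1 n2 n3 D'E.
set d1 := su_den al be z1; set d2 := su_den al be z2; set d3 := su_den al be z3.
move=> n1 n2 n3 D'E.
have m0 : 2 * Complex 0 1 * (z1 * z2 * z3) != 0.
  have i0 : Complex 0 1 != 0 :> F[i] by rewrite eq_complex /= oner_eq0 andbF.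
  have two0 : 2 != 0 :> F[i] by rewrite pnatr_eq0.
  apply: mulf_neq0 (mulf_neq0 two0 i0) _.
  apply: mulf_neq0 (mulf_neq0 _ _) _; exact: circle_neq0.
have [c10 [c20 c30]] : conjc d1 != 0 /\ conjc d2 != 0 /\ conjc d3 != 0.
  by rewrite !conjc_eq0.
apply: (mulfI m0).
have -> : 2 * Complex 0 1 * (z1 * z2 * z3) *
    (D%:C / (conjc d1 * d1 * (conjc d2 * d2) * (conjc d3 * d3))) =
  2 * Complex 0 1 * D%:C * (z1 * z2 * z3) /
    (conjc d1 * d1 * (conjc d2 * d2) * (conjc d3 * d3)).
  by ring.
rewrite DE.
have -> : 2 * Complex 0 1 * (z1 * z2 * z3) * D'%:C =
  2 * Complex 0 1 * D'%:C * (z1 * conjc d1 / d1 * (z2 * conjc d2 / d2) *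
    (z3 * conjc d3 / d3)) * (d1 * d2 * d3 / (conjc d1 * conjc d2 * conjc d3)).
  by field; rewrite n1 n2 n3 c10 c20 c30.
by rewrite D'E; field; rewrite n1 n2 n3 c10 c20 c30.
Qed.

Lemma su_den_inv al be z : su al be -> N z <= 1 ->
  su_den (conjc al) (- be) (su_act al be z) * su_den al be z = 1.
Proof.
move=> h z1; have := su_den_neq0 h z1; have := su_conj h.
rewrite /su_act /su_num /su_den rmorphN /= conjcK => <- z0.
by field.
Qed.

Lemma su_den_upper al be z : su al be -> N z <= 1 ->
  N (su_den al be z) <= 4 * N al.
Proof.
move=> h z1; apply: le_trans (sqnormcD_le _ _) _.
rewrite sqnormcM !sqnormc_conj.
have : N be * N z <= N be by rewrite ler_piMr ?sqnormc_ge0.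
have : N al - N be = 1 := h; lra.
Qed.

Lemma su_den_lower al be z : su al be -> N z <= 1 ->
  (N (su_den al be z))^-1 <= 4 * N al.
Proof.
move=> h z1; have z0 := su_den_neq0 h z1.
have -> : (N (su_den al be z))^-1 =
    N (su_den (conjc al) (- be) (su_act al be z)).
  rewrite -sqnormcV -[(su_den _ _ z)^-1]mul1r -(su_den_inv h z1).
  by rewrite mulfK.
rewrite -(sqnormc_conj al); apply: su_den_upper; first exact: su_inv.
by rewrite -subr_ge0 su_sqnormc// divr_ge0 ?sqnormc_ge0// subr_ge0.
Qed.

(* Only a bound in terms of [al] matters: its logarithm vanishes as soon as
   [al] has valuation zero. *)
Lemma su_ray_close al be u (t : F) : su al be -> circle F u -> 0 <= t < 1 ->
  let p := su_act al be (t%:C * u) in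
  let q := t%:C * su_act al be u in
  N (1 - conjc p * q) / ((1 - N p) * (1 - N q)) <= 136%:R * N al ^+ 3.
Proof.
move=> h u1 /andP[t0 t1].
set p := su_act al be _; set q := _ * su_act _ _ _; cbv zeta.
have tu1 : N (t%:C * u) < 1.
  by rewrite sqnormcM sqnormc_real [N u]u1 mulr1 expr_lt1.
have u1' : N u <= 1 by rewrite [N u]u1.
have x0 := su_den_neq0 h (ltW tu1); have v0 := su_den_neq0 h u1'.
have al1 : 1 <= N al.
  have : N al - N be = 1 := h; have := sqnormc_ge0 be; lra.
have t1' : 0 < 1 - t by rewrite subr_gt0.
have close : N (1 - conjc p * su_act al be u) <= 16 * N al ^+ 2 * (1 - t) ^+ 2.
  rewrite su_pairing//.
  have -> : 1 - conjc (t%:C * u) * u = (1 - t)%:C.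
    have := circle_conj u1; move: (u) => w ww.
    have -> : conjc (t%:C * w) = t%:C * conjc w.
      by rewrite -{2}[t%:C]conjc_real -(rmorphM (@conjc F)).
    by rewrite -mulrA ww mulr1 rmorphB rmorph1.
  rewrite sqnormcM sqnormcV sqnormc_real sqnormcM sqnormc_conj invfM mulrC.
  apply: ler_wpM2r; first exact: sqr_ge0.
  have -> : 16 * N al ^+ 2 = (4 * N al) * (4 * N al) by ring.
  by apply: ler_pM; rewrite ?invr_ge0 ?sqnormc_ge0// su_den_lower// ltW.
have p1 : N p < 1 by exact: su_disk.
have num : N (1 - conjc p * q) <= 34 * N al ^+ 2 * (1 - t) ^+ 2.
  have -> : 1 - conjc p * q = (1 - conjc p * su_act al be u) +
      (1 - t)%:C * (conjc p * su_act al be u).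
    by rewrite rmorphB rmorph1 /q; ring.
  apply: le_trans (sqnormcD_le _ _) _.
  rewrite [N (_%:C * _)]sqnormcM sqnormc_real sqnormcM sqnormc_conj.
  rewrite [N (su_act _ _ u)](su_circle h u1) mulr1.
  have : (1 - t) ^+ 2 * N p <= (1 - t) ^+ 2 by rewrite ler_piMr ?sqr_ge0// ltW.
  have : (1 - t) ^+ 2 <= N al ^+ 2 * (1 - t) ^+ 2.
    by rewrite ler_peMl ?sqr_ge0// exprn_ege1.
  have := close; move: (N p) (N _) => A B; lra.
have qE : 1 - N q = 1 - t ^+ 2.
  by rewrite sqnormcM sqnormc_real [N (su_act _ _ _)](su_circle h u1) mulr1.
have pE : 1 - N p = (1 - t ^+ 2) / N (su_den al be (t%:C * u)).
  by rewrite su_sqnormc// sqnormcM sqnormc_real [N u]u1 mulr1.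
have d0 : 0 < N (su_den al be (t%:C * u)) by rewrite sqnormc_gt0.
have dle := su_den_upper h (ltW tu1).
have t2 : 0 < 1 - t ^+ 2 by rewrite subr_gt0 expr_lt1.
have tle : 1 - t <= 1 - t ^+ 2 by rewrite lerD2l lerN2 expr2 ler_piMr// ltW.
rewrite qE pE ler_pdivrMr ?mulr_gt0 ?invr_gt0//.
move: d0 dle num; move: (N (su_den _ _ _)) (N (1 - _)) => d n d0 dle num.
apply: le_trans num _.
have -> : 136%:R * N al ^+ 3 * ((1 - t ^+ 2) / d * (1 - t ^+ 2)) =
  (34 * N al ^+ 2 * (1 - t ^+ 2) ^+ 2) * (4 * N al / d).
  by field; rewrite gt_eqF.
have m0 : 0 <= 34 * N al ^+ 2 by rewrite mulr_ge0// exprn_ge0// sqnormc_ge0.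
apply: (@le_trans _ _ (34 * N al ^+ 2 * (1 - t ^+ 2) ^+ 2)).
  by rewrite ler_wpM2l// lerXn2r// nnegrE; exact: ltW.
by apply: ler_peMr; [rewrite mulr_ge0 ?sqr_ge0|rewrite ler_pdivlMr ?mul1r].
Qed.

End SuCircle.

(** * Germs of rays *)

Section RayGerms.
Variables (R : realType) (F : rcfType).
Variables (Fna : nonarchimedean F) (beta : bigElement F).
Local Notation N := (@sqnormc F).
Local Notation "x %:C" := (real_complex F x).
Local Notation log := (logb R beta).
Local Notation reduce := (reduce R Fna beta).
Local Notation Lambda := (value_group R beta).
Local Notation dT := (tree_dist R beta).
Local Notation base := (base_point R beta).
Local Notation L0 := (@value_group0 R F beta).
Local Notation TM := (@tree_is_metric R F beta Fna).
Local Notation T4 := (@tree_four_point R F beta Fna).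
Local Notation rayd := (@ray_dist R F beta).

Lemma ray_paramP a : Lambda a -> 0 <= a ->
  0 <= ray_param beta a < 1 /\ rayd (ray_param beta a) = a.
Proof.
move=> La a0; rewrite /ray_param.
have [t t1 ta] := ray_dist_onto La a0.
by have := @xgetPex F 0 [set t : F | 0 <= t < 1 /\ log (1 - t ^+ 2)^-1 = a];
   apply; exists t.
Qed.

Lemma seg_path_ray g u a : seg_path (ray R beta g u) a =
  tree_ray R beta g u (ray_param beta a).
Proof. by []. Qed.

Lemma ray_dist_path g u a : circle F u -> Lambda a -> 0 <= a ->
  dT (base g) (seg_path (ray R beta g u) a) = a.
Proof.
move=> u1 La a0; have [t1 ta] := ray_paramP La a0.
by rewrite seg_path_ray tree_dist_base_ray.
Qed.

Lemma ray_start g u : circle F u -> seg_start (ray R beta g u) = base g.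
Proof.
move=> u1; apply/esym/(is_metric_eq TM).
by rewrite (ray_dist_path g u1 L0).
Qed.

Lemma ray_is_segment g u : circle F u -> is_segment Lambda dT (ray R beta g u).
Proof.
move=> u1; split=> //=; first exact: value_group1.
move=> a c [La /andP[a0 _]] [Lc /andP[c0 _]].
have [/andP[t0 t1] ta] := ray_paramP La a0.
have [/andP[s0 s1] sc] := ray_paramP Lc c0.
change (dT (tree_ray R beta g u (ray_param beta a))
  (tree_ray R beta g u (ray_param beta c)) = `|a - c|).
wlog ts : a c La Lc a0 c0 t0 t1 ta s0 s1 sc /
    ray_param beta a <= ray_param beta c => [hw|].
  have [/hw|/ltW/hw] := leP (ray_param beta a) (ray_param beta c); first exact.
  by rewrite distrC (is_metric_sym TM); exact.
have := tree_dist_ray R beta Fna g u1 t0 ts s1; rewrite ta sc => e.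
have := is_metric_ge0 TM (tree_ray R beta g u (ray_param beta a))
  (tree_ray R beta g u (ray_param beta c)).
by rewrite e distrC => ca; rewrite ger0_norm.
Qed.

Lemma ray_nondeg g u : circle F u -> nondeg_segment Lambda dT (ray R beta g u).
Proof. by move=> u1; split; [exact: ray_is_segment|rewrite /= ltr01]. Qed.

Lemma ray_germ_mem g u : circle F u ->
  tree_germs (base g) (ray_germ R beta g u).
Proof.
move=> u1; exists (ray R beta g u) => //.
by split; [exact: ray_nondeg|exact: ray_start].
Qed.

Lemma germ_is_ray g c : tree_germs (base g) c ->
  exists2 u, circle F u & c = ray_germ R beta g u.
Proof.
move=> [s [sn sg] <-]; have [sS sl] := sn.
have [u [t [u1 t1 st]]] := tree_polar g (seg_end s).
exists u => //; apply/(germ_eq s (ray_nondeg g u1)).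
exists (Num.min (seg_len s) 1); split.
- by rewrite lt_min sl ltr01.
- by rewrite ge_min lexx.
- by rewrite ge_min lexx orbT.
move=> a La /andP[a0]; rewrite lt_min => /andP[al a1].
have sa : seg_dom Lambda s a by split=> //; rewrite a0 ltW.
have [p1 pa] := ray_paramP La a0.
have lt : seg_len s = rayd t.
  by rewrite -(seg_lenE L0 sS) sg st (tree_dist_base_ray R beta Fna).
apply: (@between_inj _ _ _ TM T4 (base g) (seg_end s)).
- by rewrite -sg; exact: (seg_between L0 sS sa).
- have [/andP[p0 _] /andP[_ lt1]] := (p1, t1).
  have /ltW pt : ray_param beta a < t.
    by apply: (@ray_dist_lt R F beta); rewrite ?pa -?lt.
  have e1 := tree_dist_ray R beta Fna g u1 p0 pt lt1.
  have e2 := tree_dist_base_ray R beta Fna g u1 p1.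
  have e3 := tree_dist_base_ray R beta Fna g u1 t1.
  by rewrite /between st seg_path_ray e1 e2 e3 addrC subrK.
- by rewrite ray_dist_path// -{1}sg (seg_dist_start L0 sS).
Qed.

Definition ray_pairing u v (t : F) : F := N (1 - (t ^+ 2)%:C * (conjc u * v)).

Lemma tree_dist_rays g u v t : circle F u -> circle F v -> 0 <= t < 1 ->
  0 < ray_pairing u v t /\
  dT (tree_ray R beta g u t) (tree_ray R beta g v t) =
    log (ray_pairing u v t) - 2 * log (1 - t ^+ 2).
Proof.
move=> u1 v1 t1; rewrite (tree_distE R beta Fna) disk_dist_act.
have e : N (1 - conjc (ray_point u t) * ray_point v t) = ray_pairing u v t.
  rewrite !ray_pointE// /ray_pairing.
  have -> : conjc (t%:C * u) = t%:C * conjc u.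
    by rewrite -{2}[t%:C]conjc_real -(rmorphM (@conjc F)).
  by congr (N (1 - _)); rewrite expr2 (rmorphM (real_complex F)); ring.
have p0 : 0 < ray_pairing u v t by rewrite -e pairing_gt0.
split=> //; rewrite /disk_dist e.
have t2 := one_sub_sqr_gt0 t1.
rewrite !ray_pointE// !sqnormcM !sqnormc_real [N u]u1 [N v]v1 !mulr1.
by rewrite logb_div ?mulr_gt0// logbM//; ring.
Qed.

Lemma sqnormc_circle_sub u v : circle F u -> N (1 - conjc u * v) = N (u - v).
Proof.
move=> u1; rewrite -(circle_conj u1) -mulrBr sqnormcM sqnormc_conj.
by rewrite [N u]u1 mul1r.
Qed.

Lemma ray_germ_eq g u v : circle F u -> circle F v ->
  ray_germ R beta g u = ray_germ R beta g v <-> reduce u = reduce v.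
Proof.
move=> u1 v1; rewrite /ray_germ (germ_eq _ (ray_nondeg g v1)) reduce_eq//.
have uvN := sqnormc_circle_sub v u1.
split=> [[e [e0 _ _ euv]]|[->|luv]].
- have [uv|nuv] := eqVneq u v; [by left|right].
  have uv0 : 0 < N (u - v) by rewrite sqnormc_gt0// subr_eq0.
  have [a La /andP[a0 ae]] := value_group_small beta e0.
  have := euv a La; rewrite (ltW a0) ae => /(_ isT); rewrite !seg_path_ray.
  have [t1 ta] := ray_paramP La (ltW a0).
  move: (ray_param beta a) t1 ta => t t1 ta uvt.
  have [p0 pE] := tree_dist_rays g u1 v1 t1.
  move: pE; rewrite uvt (is_metric_refl TM) => pE.
  have t2 := one_sub_sqr_gt0 t1.
  move: ta; rewrite /ray_dist logbV// => ta.
  have thalf : 1 - t ^+ 2 < 2^-1.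
    rewrite ltNge; apply/negP => th.
    have := @ler_logb R F beta _ _ _ th; rewrite logbV// logb_nat//.
    by rewrite invr_gt0 ltr0n => /(_ isT); lra.
  have key : N (u - v) <= 8 * (ray_pairing u v t + (1 - t ^+ 2) ^+ 2).
    have : N ((t ^+ 2)%:C * (1 - conjc u * v)) <=
        2 * (ray_pairing u v t + (1 - t ^+ 2) ^+ 2).
      have -> : (t ^+ 2)%:C * (1 - conjc u * v) =
          (1 - (t ^+ 2)%:C * (conjc u * v)) + - (1 - t ^+ 2)%:C.
        by rewrite rmorphB rmorph1; ring.
      by apply: le_trans (sqnormcD_le _ _) _; rewrite sqnormcN sqnormc_real.
    rewrite sqnormcM sqnormc_real uvN => h.
    have t4 : 4^-1 <= (t ^+ 2) ^+ 2.
      have -> : 4^-1 = 2^-1 ^+ 2 :> F by field.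
      by rewrite lerXn2r ?nnegrE ?invr_ge0 ?sqr_ge0//; lra.
    have : 4^-1 * N (u - v) <= (t ^+ 2) ^+ 2 * N (u - v).
      by rewrite ler_wpM2r// ltW.
    lra.
  have lsq : log ((1 - t ^+ 2) ^+ 2) = 2 * log (1 - t ^+ 2) by rewrite logbX.
  have sq0 : 0 < (1 - t ^+ 2) ^+ 2 by rewrite exprn_gt0.
  have [pq|qp] := leP (ray_pairing u v t) ((1 - t ^+ 2) ^+ 2).
    apply: (@le_lt_trans _ _ (log ((1 - t ^+ 2) ^+ 2))); last by lra.
    by apply: (@ler_logb_nat _ _ _ Fna 16) => //; lra.
  apply: (@le_lt_trans _ _ (log (ray_pairing u v t))); last by lra.
  by apply: (@ler_logb_nat _ _ _ Fna 16) => //; lra.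
- exact: (same_germ_refl (ray_nondeg g v1)).
- have [->|nuv] := eqVneq u v; first exact: (same_germ_refl (ray_nondeg g v1)).
  have uv0 : 0 < N (u - v) by rewrite sqnormc_gt0// subr_eq0.
  exists (Num.min 1 (- log (N (u - v)) / 2)); split.
  + by rewrite lt_min ltr01 divr_gt0// oppr_gt0.
  + by rewrite ge_min lexx.
  + by rewrite ge_min lexx.
  move=> a La /andP[a0]; rewrite lt_min => /andP[a1 al]; rewrite !seg_path_ray.
  have [t1 ta] := ray_paramP La a0.
  move: (ray_param beta a) t1 ta => t t1 ta.
  have [p0 pE] := tree_dist_rays g u1 v1 t1.
  have t2 := one_sub_sqr_gt0 t1.
  move: ta; rewrite /ray_dist logbV// => ta.
  apply: (is_metric_eq TM); rewrite pE.
  have key : ray_pairing u v t <= 2 * ((1 - t ^+ 2) ^+ 2 + N (u - v)).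
    rewrite /ray_pairing.
    have -> : 1 - (t ^+ 2)%:C * (conjc u * v) =
        (1 - t ^+ 2)%:C + (t ^+ 2)%:C * (1 - conjc u * v).
      by rewrite rmorphB rmorph1; ring.
    apply: le_trans (sqnormcD_le _ _) _.
    rewrite sqnormc_real sqnormcM sqnormc_real uvN ler_pM2l// lerD2l.
    rewrite ler_piMl ?sqnormc_ge0// -exprM exprn_ile1//.
      by case/andP: t1.
    by case/andP: t1 => _ /ltW.
  have lsq : log ((1 - t ^+ 2) ^+ 2) = 2 * log (1 - t ^+ 2) by rewrite logbX.
  have sq0 : 0 < (1 - t ^+ 2) ^+ 2 by rewrite exprn_gt0.
  suff : log (ray_pairing u v t) <= log ((1 - t ^+ 2) ^+ 2) by lra.
  have [pq|qp] := leP (N (u - v)) ((1 - t ^+ 2) ^+ 2).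
    by apply: (@ler_logb_nat _ _ _ Fna 4) => //; lra.
  apply: (@le_trans _ _ (log (N (u - v)))); last by lra.
  by apply: (@ler_logb_nat _ _ _ Fna 4) => //; lra.
Qed.

(* Two isometries with the same base point differ by an element of SU(1,1) with
   entries in the valuation ring, which acts on germs by its boundary action. *)
Lemma ray_germ_change g g' : base g = base g' -> exists al be,
  [/\ su al be, log (N al) = 0 &
    forall u, circle F u ->
      ray_germ R beta g u = ray_germ R beta g' (su_act al be u)].
Proof.
move=> gg'; have [a1 [b1 [h1 gE]]] := disk_act_su g.
have [a2 [b2 [h2 g'E]]] := disk_act_su g'.
pose al := conjc a2 * a1 + - b2 * conjc b1.
pose be := conjc a2 * b1 + - b2 * conjc a1.
have h : su al be by apply: su_mul => //; exact: su_inv.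
have [k kE] := su_realized h.
have g'k z : disk_act g' (disk_act k z) = disk_act g z.
  apply: val_inj; rewrite [LHS]g'E [RHS]gE kE /al /be -su_comp ?su_actK//.
  - by rewrite -gE ltW// disk_lt1.
  - by rewrite ltW// disk_lt1.
have Nal : log (N al) = 0.
  move: gg'; rewrite /base_point => /(tree_pi_eq R beta Fna).
  rewrite -g'k disk_dist_act disk_dist_sym /disk_dist.
  have -> : conjc (origin F) * disk_act k (origin F) = 0.
    by rewrite conjc0 mul0r.
  have -> : N (origin F) = 0 by rewrite /sqnormc /= expr0n addr0.
  rewrite subr0 subr0 sqnormc1 !mul1r kE.
  have d0 : su_den al be (origin F) = conjc al by rewrite /su_den mulr0 add0r.
  have al0 : conjc al != 0.
    by rewrite -d0 su_den_neq0// /sqnormc /= expr0n addr0.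
  rewrite su_sqnormc// ?d0// sqnormc_conj.
  have -> : N (origin F) = 0 by rewrite /sqnormc /= expr0n addr0.
  by rewrite subr0 mul1r invrK.
exists al, be; split=> // u u1.
apply/(germ_eq _ (ray_nondeg g' (su_circle h u1))).
exists 1; split=> // a La /andP[a0 _]; rewrite !seg_path_ray.
have [t1 _] := ray_paramP La a0; move: (ray_param beta a) t1 => t t1.
apply: (is_metric_eq TM).
rewrite (tree_distE R beta Fna) -g'k disk_dist_act /disk_dist.
rewrite kE !ray_pointE//; last exact: su_circle.
have := su_ray_close h u1 t1; cbv zeta.
have al0 : 0 < N al.
  by have : N al - N be = 1 := h; have := sqnormc_ge0 be; lra.
have tu (v : F[i]) : circle F v -> N (t%:C * v) < 1.
  move=> v1; rewrite sqnormcM sqnormc_real [N v]v1 mulr1.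
  by case/andP: t1 => ? ?; rewrite expr_lt1.
set p := su_act al be (t%:C * u); set q := t%:C * su_act al be u.
have p1 : N p < 1 by apply: su_disk => //; exact: tu.
have q1 : N q < 1 by apply: tu; exact: su_circle.
move=> close; have -> : 0 = log (N al ^+ 3) by rewrite logbX// Nal mulr0.
apply: (ler_logb_nat R beta Fna _ _ close); last by rewrite exprn_gt0.
rewrite divr_gt0 ?mulr_gt0 ?subr_gt0//.
by have := pairing_gt0 (Disk p1) (Disk q1).
Qed.

End RayGerms.

Section TreeOrder.
Variables (R : realType) (F : rcfType).
Variables (Fna : nonarchimedean F) (beta : bigElement F).
Local Notation N := (@sqnormc F).
Local Notation log := (logb R beta).
Local Notation O := (val_ring R beta Fna).
Local Notation K := (resField R Fna beta).
Local Notation reduce := (reduce R Fna beta).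
Local Notation base := (base_point R beta).
Local Notation ray_germ := (ray_germ R beta).

Lemma circle_det_val_ring (u1 u2 u3 : F[i]) :
  circle F u1 -> circle F u2 -> circle F u3 -> circle_det u1 u2 u3 \in O.
Proof.
move=> c1 c2 c3.
have [? ?] := circle_val_ring R Fna beta c1.
have [? ?] := circle_val_ring R Fna beta c2.
have [? ?] := circle_val_ring R Fna beta c3.
by rewrite /circle_det rpredB// rpredM// rpredB.
Qed.

Lemma circle_order_su (al be u1 u2 u3 : F[i]) : su al be -> log (N al) = 0 ->
  circle F u1 -> circle F u2 -> circle F u3 ->
  circle_order (reduce (su_act al be u1)) (reduce (su_act al be u2))
    (reduce (su_act al be u3)) =
  circle_order (reduce u1) (reduce u2) (reduce u3).
Proof.
move=> h lal c1 c2 c3.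
rewrite (circle_order_reduce R Fna beta c1 c2 c3).
rewrite (circle_order_reduce R Fna beta (su_circle h c1) (su_circle h c2)
  (su_circle h c3)) (circle_det_su h c1 c2 c3).
have al0 : 0 < N al.
  by have : N al - N be = 1 := h; have := sqnormc_ge0 be; lra.
have den u : circle F u ->
    0 < N (su_den al be u) /\ log (N (su_den al be u)) = 0.
  move=> u1'; have ule : N u <= 1 by rewrite [N u]u1'.
  have d0 : 0 < N (su_den al be u) by rewrite sqnormc_gt0// su_den_neq0.
  split=> //; apply/eqP; rewrite eq_le; apply/andP; split.
    rewrite -lal.
    exact: (ler_logb_nat R beta Fna d0 al0 (su_den_upper h ule)).
  rewrite -oppr_le0 -logbV// -lal.
  apply: (ler_logb_nat R beta Fna _ al0 (su_den_lower h ule)).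
  by rewrite invr_gt0.
have [n1 l1] := den _ c1; have [n2 l2] := den _ c2; have [n3 l3] := den _ c3.
set n := _ * _ * _; have n0 : 0 < n by rewrite !mulr_gt0.
have ln : log n = 0 by rewrite !logbM ?mulr_gt0// l1 l2 l3 !addr0.
apply: sgz_residueM; rewrite ?invrK ?invr_gt0//.
- exact: circle_det_val_ring.
- by apply: val_ring_log; rewrite ?invr_gt0// logbV// ln oppr0.
- by apply: val_ring_log; rewrite ?ln.
Qed.

Lemma germ_direction_ray g u : circle F u ->
  germ_direction Fna g (ray_germ g u) = reduce u.
Proof.
move=> u1; rewrite /germ_direction; set S := [set _ | _].
have [|v [v1 <- uv]] := @xgetPex _ 0 S _; last first.
  exact/(ray_germ_eq R Fna beta g v1 u1).
by exists (reduce u), u.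
Qed.

Lemma some_translationP (p : tree R beta) : base (some_translation p) = p.
Proof.
by have := @xgetPex _ 1%g [set g | base g = p] (base_point_surj p).
Qed.

Lemma tree_order_ray g u1 u2 u3 : circle F u1 -> circle F u2 -> circle F u3 ->
  tree_order Fna (base g) (ray_germ g u1) (ray_germ g u2) (ray_germ g u3) =
  circle_order (reduce u1) (reduce u2) (reduce u3).
Proof.
move=> c1 c2 c3; rewrite /tree_order.
have [al [be [h lal change]]] :=
  ray_germ_change Fna (esym (some_translationP (base g))).
rewrite (change _ c1) (change _ c2) (change _ c3).
rewrite (germ_direction_ray _ (su_circle h c1)).
rewrite (germ_direction_ray _ (su_circle h c2)).
rewrite (germ_direction_ray _ (su_circle h c3)).
exact: circle_order_su.
Qed.

Lemma tree_order_cyclic (p : tree R beta) :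
  cyclic_order (tree_germs p) (tree_order Fna p).
Proof.
have germP c : tree_germs p c -> exists2 u, circle F u &
    c = ray_germ (some_translation p) u.
  by rewrite -{1}[p]some_translationP; exact: germ_is_ray.
apply: cyclic_order_pullback (@cyclic_order_circle K).
  move=> c /germP[u u1 ->]; rewrite (germ_direction_ray _ u1).
  exact: reduce_circle.
move=> c c' /germP[u u1 ->] /germP[u' u'1 ->].
rewrite (germ_direction_ray _ u1) (germ_direction_ray _ u'1).
by move=> /(ray_germ_eq R Fna beta _ u1 u'1).
Qed.

Lemma germ_bijection g :
  exists B : K[i] -> set (segment R (tree R beta)),
   [/\ set_bij (circle K) (tree_germs (base g)) B,
       forall u : F[i], circle F u -> B (reduce u) = ray_germ g u &
       forall z1 z2 z3, circle _ z1 -> circle _ z2 -> circle _ z3 ->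
         tree_order Fna (base g) (B z1) (B z2) (B z3) = circle_order z1 z2 z3].
Proof.
have /choice[lift liftP] : forall z : K[i], exists u, circle K z ->
    circle F u /\ reduce u = z.
  move=> z; have [/reduce_onto[u u1 uz]|nz] := pselect (circle K z).
    by exists u.
  by exists 0 => /nz.
have Bred u : circle F u -> ray_germ g (lift (reduce u)) = ray_germ g u.
  move=> u1; have [l1 lu] := liftP _ (reduce_circle R Fna beta u1).
  exact/(ray_germ_eq R Fna beta g l1 u1).
exists (fun z => ray_germ g (lift z)); split; [|exact: Bred|].
- split.
  + by move=> z /liftP[l1 _]; exact: (ray_germ_mem R Fna beta g l1).
  + move=> z w /[!inE] /liftP[z1 zE] /liftP[w1 wE].
    by move=> /(ray_germ_eq R Fna beta g z1 w1); rewrite zE wE.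
  + move=> c /(germ_is_ray Fna)[u u1 ->].
    by exists (reduce u); [exact: reduce_circle|exact: Bred].
- move=> z1 z2 z3 /liftP[c1 e1] /liftP[c2 e2] /liftP[c3 e3].
  by rewrite (tree_order_ray g c1 c2 c3) e1 e2 e3.
Qed.

Lemma tree_sc_two_germs (P : tree_sc R beta) : ~ (exists p, tree_incl p = P) ->
  (tree_sc_germs P #= `I_2)%card.
Proof.
move=> nP; exact: (two_germs (@value_group0 R F beta) (@value_groupB R F beta)
  (@value_group_half R F beta) (@value_group_small R F beta)
  (tree_is_metric R beta Fna) (tree_four_point Fna)
  (tree_dist_value Fna) (tree_convex Fna) (@tree_incl_const R F beta) nP).
Qed.

Lemma tree_sc_orientation : orientation (tree_sc_dist R beta) (or_O Fna).
Proof.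
split.
  exact: (completion_Rtree (@value_group0 R F beta) (@value_groupB R F beta)
    (@value_group_small R F beta) (tree_is_metric R beta Fna)
    (tree_four_point Fna) (tree_dist_value Fna) (tree_convex Fna)
    (@tree_incl_const R F beta)).
move=> P; rewrite /or_O; case: pselect => [inT|nP].
  case: cid => p /= <-.
  exact: (cyclic_order_restrict (@value_group0 R F beta)
    (@value_groupB R F beta) (@value_group_small R F beta)
    (tree_is_metric R beta Fna)
    (tree_four_point Fna) (tree_dist_value Fna) (tree_convex Fna)
    (@tree_incl_const R F beta) (tree_order_cyclic p)).
apply: cyclic_order_zero.
by have := tree_sc_two_germs nP; rewrite card_eq_le => /andP[].
Qed.

End TreeOrder.

Theorem corollary4p22 (R : realType) (Gamma : groupType) (F : rcfType)
    (phi : {multiplicative Gamma -> PSL2 F})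
    (Gamma_fg : finitely_generated Gamma)
    (phi_red : reductive phi)
    (Fna : nonarchimedean F)
    (F_min : minimal_field phi)
    (beta : bigElement F) :
  (forall g : PSL2 F,
     exists B : (resField R Fna beta)[i] -> set (segment R (tree R beta)),
     [/\ set_bij (circle (resField R Fna beta))
           (tree_germs (base_point R beta g)) B,
         forall u : F[i], circle F u ->
           B (reduce R Fna beta u) = ray_germ R beta g u &
         forall z1 z2 z3, circle _ z1 -> circle _ z2 -> circle _ z3 ->
           tree_order Fna (base_point R beta g) (B z1) (B z2) (B z3) =
           circle_order z1 z2 z3]) /\
  (forall p : tree R beta, cyclic_order (tree_germs p) (tree_order Fna p)) /\
  (forall P : tree_sc R beta, ~ (exists p, tree_incl p = P) ->
     (tree_sc_germs P #= `I_2)%card) /\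
  orientation (tree_sc_dist R beta) (or_O Fna).
Proof.
split; [exact: germ_bijection|split; [exact: tree_order_cyclic|split]].
  exact: tree_sc_two_germs.
exact: tree_sc_orientation.
Qed.
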